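(* For every $d\in\mathbb{N}$ and every $0<\beta<d$, there exist a probability density $\mu$ on $\mathbb{R}^d$ and a target function $f^*:\mathbb{R}^d\to\{\pm1\}$ satisfying the regularity assumption below, and absolute constants $C_1,C_2\in(0,1)$, such that with $c(\beta,d):=C_1^{\beta}\cdot(1-\beta/d)>0$, for every $p\in(0,0.49)$, \[ \mathcal{L}(\hat{h}_\beta)\geq C_2\cdot c(\beta,d). \]
   Context: Training data $S=(\mathbf{x}_i,y_i)_{i=1}^m\subset\mathbb{R}^d\times\{\pm1\}$: the $\mathbf{x}_i$ are i.i.d. from the distribution $\mathcal{D}_\mathbf{x}$ with density $\mu$, and independently for each $i$, $y_i=f^*(\mathbf{x}_i)$ with probability $1-p$ and $y_i=-f^*(\mathbf{x}_i)$ with probability $p$. The Nadaraya–Watson interpolator is $\hat{h}_\beta(\mathbf{x})=\mathrm{sign}\big(\sum_{i=1}^m y_i\|\mathbf{x}-\mathbf{x}_i\|^{-\beta}\big)$ if $\mathbf{x}\notin\{\mathbf{x}_1,\dots,\mathbf{x}_m\}$, and $\hat{h}_\beta(\mathbf{x}_i)=y_i$. The asymptotic clean classification error is $\mathcal{L}(\hat{h}_\beta)=\lim_{m\to\infty}\mathbb{E}_S\big[\Pr_{\mathbf{x}\sim\mathcal{D}_\mathbf{x}}[\hat{h}_\beta(\mathbf{x})\neq f^*(\mathbf{x})]\big]$; if the limit does not exist, the lower bound is to be read for the $\liminf$. Regularity assumption: $\mu$ is continuous at Lebesgue-almost every $\mathbf{x}\in\mathbb{R}^d$, and for Lebesgue-almost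 every $\mathbf{x}$ there is a neighborhood of $\mathbf{x}$ on which $f^*$ is constant. *)

(* Defs.v *)
(* R^d is modelled as d.-tuple R
   (with the library's product sigma-algebra on tuples = Borel sets of R^d). *)
From HB Require Import structures.
From mathcomp Require Import all_boot all_order all_algebra.
From mathcomp Require Import all_classical all_reals all_analysis.
Set Implicit Arguments. Unset Strict Implicit. Unset Printing Implicit Defensive.
Import Order.TTheory GRing.Theory Num.Theory.
Local Open Scope classical_set_scope.
Local Open Scope ring_scope.

Section Defs.
Variable R : realType.

Fixpoint iter_int (T : Type) (I : (T -> \bar R) -> \bar R) (n : nat)
  : (n.-tuple T -> \bar R) -> \bar R :=
  match n with
  | 0 => fun g => g [tuple]
  | n'.+1 => fun g => I (fun x => @iter_int T I n' (fun t => g (cons_tuple x t)))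
  end.
Arguments iter_int {T} I n g.

(* Lebesgue integral on R^d (iterated one-dimensional Lebesgue integrals;
   by Tonelli this is the d-dimensional Lebesgue integral of nonnegative
   measurable functions). *)
Definition intRd (d : nat) (g : d.-tuple R -> \bar R) : \bar R :=
  iter_int (fun F : R -> \bar R => (\int[lebesgue_measure]_x F x)%E) d g.

Definition lebesgue_null (d : nat) (A : set (d.-tuple R)) : Prop :=
  exists B : set (d.-tuple R), measurable B /\ A `<=` B /\
    intRd (fun x => (\1_B x)%:E) = 0%E.

Definition edist (d : nat) (x y : d.-tuple R) : R :=
  Num.sqrt (\sum_(i < d) (tnth x i - tnth y i) ^+ 2).

Definition continuous_at_Rd (d : nat) (g : d.-tuple R -> R) (x : d.-tuple R) : Prop :=
  forall e : R, 0 < e -> exists2 r : R, 0 < r &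
    forall y, edist x y < r -> `|g y - g x| < e.

Definition locally_constant_at (d : nat) (g : d.-tuple R -> R) (x : d.-tuple R) : Prop :=
  exists2 r : R, 0 < r & forall y, edist x y < r -> g y = g x.

Definition is_density (d : nat) (mu : d.-tuple R -> R) : Prop :=
  measurable_fun setT mu /\ (forall x, 0 <= mu x) /\
  intRd (fun x => (mu x)%:E) = 1%E.

Definition regular (d : nat) (mu f : d.-tuple R -> R) : Prop :=
  lebesgue_null [set x | ~ continuous_at_Rd mu x] /\
  lebesgue_null [set x | ~ locally_constant_at f x].

(* sign, with the convention sign(0) = +1 (ties have probability zero) *)
Definition sgn1 (r : R) : R := if 0 <= r then 1 else -1.

Definition nw_interp (d m : nat) (beta : R) (xs : m.-tuple (d.-tuple R))
  (ys : m.-tuple R) (x : d.-tuple R) : R :=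
  match [pick i : 'I_m | tnth xs i == x] with
  | Some i => tnth ys i
  | None => sgn1 (\sum_(i < m) tnth ys i * (edist x (tnth xs i)) `^ (- beta))
  end.

Definition noisy_labels (d m : nat) (f : d.-tuple R -> R)
  (xs : m.-tuple (d.-tuple R)) (s : {ffun 'I_m -> bool}) : m.-tuple R :=
  [tuple (if s i then - f (tnth xs i) else f (tnth xs i)) | i < m].

Definition clean_error (d : nat) (mu f h : d.-tuple R -> R) : \bar R :=
  intRd (fun x => (mu x * (h x != f x)%:R)%:E).

(* E_S [ Pr_x [ h_beta_S (x) <> f (x) ] ] for a sample of size m:
   x_i iid with density mu, labels flipped independently with probability p *)
Definition expected_error (d : nat) (beta : R) (mu f : d.-tuple R -> R)
  (p : R) (m : nat) : \bar R :=
  iter_int (@intRd d) m (fun xs =>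
    ((\prod_(i < m) mu (tnth xs i))%:E *
     \sum_(s : {ffun 'I_m -> bool})
        ((\prod_(i < m) (if s i then p else 1 - p))%:E *
         clean_error mu f (nw_interp beta xs (noisy_labels f xs s))))%E).

End Defs.

(* Main.v *)
Require Import Defs.
From HB Require Import structures.
From mathcomp Require Import all_boot all_order all_algebra.
From mathcomp Require Import all_classical all_reals all_analysis.
From mathcomp Require Import measurable_realfun ring lra.
Set Implicit Arguments. Unset Strict Implicit. Unset Printing Implicit Defensive.
Import Order.TTheory GRing.Theory Num.Theory.
Import numFieldNormedType.Exports.
Local Open Scope classical_set_scope.
Local Open Scope ring_scope.

(** Let [mu] be uniform on the unit cube and let the target be [+1] on the thin
strips [k/N <= x_0 < (k + 1/8)/N] and [-1] elsewhere.  Since [beta < d], the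
kernel [|x - y|^(-beta)] is integrable, so for [N] large (depending on [d] and
[beta] only) the vote received by a point of a strip is governed by points far
from it compared with [1/N]; there the kernel hardly varies within a strip
period, and the majority label [-1] wins.  Hence a constant fraction of the mass
1/8 of the strips is misclassified, and the error stays above 1/32, which is
more than what is claimed.

Quantitatively, cap the kernel at distance [rho = 2^-K].  The singular remainder
has mean at most [tau / 2], so by Markov its empirical sum reaches [m tau] with
probability at most 1/2.  The capped kernel is bounded, so an exponential
(Chernoff) bound makes the probability that the capped vote exceeds [-m tau] at
most [q^m] with [q < 1] uniform in the point.  The noise multiplies the mean vote
by [1 - 2p > 1/50], so one [tau] serves all [p < 0.49]. *)

(* [all_analysis] has its own [edist]. *)
Local Notation edist := Defs.edist.

(** * Iterated integrals and product probabilities on tuples *)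

Section IteratedIntegrals.
Context {R : realType}.
Local Open Scope ereal_scope.

Lemma iter_int_ge0 (T : Type) (I : (T -> \bar R) -> \bar R) n
    (g : n.-tuple T -> \bar R) :
  (forall F, (forall x, 0 <= F x) -> 0 <= I F) ->
  (forall x, 0 <= g x) -> 0 <= iter_int I g.
Proof.
move=> I0; elim: n g => [|n IHn] g g0 //=.
by apply: I0 => x; apply: IHn.
Qed.

Lemma le_iter_int (T : Type) (I : (T -> \bar R) -> \bar R) n
    (g h : n.-tuple T -> \bar R) :
  (forall F, (forall x, 0 <= F x) -> 0 <= I F) ->
  (forall F G, (forall x, 0 <= F x) -> (forall x, F x <= G x) -> I F <= I G) ->
  (forall x, 0 <= g x) -> (forall x, g x <= h x) ->
  iter_int I g <= iter_int I h.
Proof.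
move=> I0 Ile; elim: n g h => [|n IHn] g h g0 gh //=.
by apply: Ile => x; [apply: iter_int_ge0|apply: IHn].
Qed.

Lemma iter_int0 (T : Type) (I : (T -> \bar R) -> \bar R) n :
  I (fun=> 0) = 0 -> iter_int I (fun _ : n.-tuple T => 0) = 0.
Proof.
move=> I0; elim: n => [|n IHn] //=.
by rewrite -[RHS]I0; congr I; apply/funext => x.
Qed.

(* The weights are 0 or 1 so that they commute with an arbitrary functional,
   even at a non-measurable integrand. *)
Lemma iter_int_weight (T : Type) (I : (T -> \bar R) -> \bar R) (c : T -> bool)
    n (g : n.-tuple T -> \bar R) :
  I (fun=> 0) = 0 ->
  iter_int I (fun x => (\prod_(i < n) (c (tnth x i))%:R)%:E * g x) =
  iter_int (fun F => I (fun x => (c x)%:R%:E * F x)) g.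
Proof.
move=> I0; elim: n g => [|n IHn] g /=; first by rewrite big_ord0 mul1e.
congr I; apply/funext => x; rewrite -IHn.
case: (boolP (c x)) => cx; last first.
  rewrite mul0e -[RHS](@iter_int0 _ I n I0); congr (iter_int I); apply/funext => t.
  by rewrite big_ord_recl tnth0 (negbTE cx) mul0r mul0e.
rewrite mul1e; congr (iter_int I); apply/funext => t.
rewrite big_ord_recl tnth0 cx mul1r; congr (_%:E * _).
by apply: eq_bigr => i _; rewrite tnthS.
Qed.

Definition cons_pair d (T : measurableType d) n (z : T * n.-tuple T) : n.+1.-tuple T :=
  cons_tuple z.1 z.2.

Lemma measurable_cons_pair d (T : measurableType d) n :
  measurable_fun [set: T * n.-tuple T] (@cons_pair d T n).
Proof. by apply: measurable_cons. Qed.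

HB.instance Definition _ d (T : measurableType d) n :=
  @isMeasurableFun.Build _ _ _ _ (@cons_pair d T n) (@measurable_cons_pair d T n).

Context d (T : measurableType d) (P : probability T R).

(** The [n]-fold product of [P], built as the image of a binary product under [cons_pair] so that it
    follows the recursion of [iter_int]. *)
Fixpoint tuple_prob n : probability (n.-tuple T) R :=
  match n with
  | 0 => [the probability _ R of \d_([tuple] : 0.-tuple T)]
  | n'.+1 => [the probability _ R of
      distribution [the probability _ R of P \x tuple_prob n'] (@cons_pair d T n')]
  end.

Lemma measurable_cons_comp n (g : n.+1.-tuple T -> \bar R) :
  measurable_fun [set: n.+1.-tuple T] g ->
  measurable_fun [set: T * n.-tuple T] (g \o @cons_pair d T n).
Proof. by move=> mg; apply: measurableT_comp => //; exact: measurable_cons_pair. Qed.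

Lemma measurable_cons_section n (g : n.+1.-tuple T -> \bar R) x :
  measurable_fun [set: n.+1.-tuple T] g ->
  measurable_fun [set: n.-tuple T] (fun t => g (cons_tuple x t)).
Proof. by move=> mg; apply: measurableT_comp => //; apply: measurable_cons. Qed.

Lemma measurable_integral_cons n (g : n.+1.-tuple T -> \bar R) :
  measurable_fun [set: n.+1.-tuple T] g -> (forall x, 0 <= g x) ->
  measurable_fun setT (fun x => \int[tuple_prob n]_t g (cons_tuple x t)).
Proof.
move=> mg g0.
apply: (measurable_fun_fubini_tonelli_F (g \o @cons_pair d T n)).
  exact: measurable_cons_comp.
by move=> z; exact: g0.
Qed.

Lemma integral_tuple_prob0 (g : 0.-tuple T -> \bar R) :
  measurable_fun [set: 0.-tuple T] g -> \int[tuple_prob 0]_x g x = g [tuple].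
Proof. by move=> mg; rewrite /= integral_dirac// diracT mul1e. Qed.

Lemma integral_tuple_probS n (g : n.+1.-tuple T -> \bar R) :
  measurable_fun [set: n.+1.-tuple T] g -> (forall x, 0 <= g x) ->
  \int[tuple_prob n.+1]_x g x =
  \int[P]_x \int[tuple_prob n]_t g (cons_tuple x t).
Proof.
move=> mg g0 /=.
rewrite (ge0_integral_pushforward (@measurable_cons_pair d T n))//.
rewrite preimage_setT.
exact: (@fubini_tonelli1 _ _ _ _ _ P (tuple_prob n) (g \o @cons_pair d T n)
  (measurable_cons_comp mg) (fun z => g0 _)).
Qed.

Lemma integral_tuple_prob_swap n (g : n.+1.-tuple T -> \bar R) :
  measurable_fun [set: n.+1.-tuple T] g -> (forall x, 0 <= g x) ->
  \int[tuple_prob n.+1]_x g x =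
   \int[tuple_prob n]_t \int[P]_x g (cons_tuple x t).
Proof.
move=> mg g0; rewrite integral_tuple_probS//.
exact: (@fubini_tonelli _ _ _ _ _ P (tuple_prob n) (g \o @cons_pair d T n)
  (measurable_cons_comp mg) (fun z => g0 _)).
Qed.

Lemma measurable_integral_cons_swap n (g : n.+1.-tuple T -> \bar R) :
  measurable_fun [set: n.+1.-tuple T] g -> (forall x, 0 <= g x) ->
  measurable_fun [set: n.-tuple T] (fun t => \int[P]_x g (cons_tuple x t)).
Proof.
move=> mg g0.
apply: (measurable_fun_fubini_tonelli_G (g \o @cons_pair d T n)).
  exact: measurable_cons_comp.
by move=> z; exact: g0.
Qed.

(** The bridge from iterated functionals to measure theory. It serves at two levels: for the
    coordinates of one point, and for the points of a sample. *)
Lemma iter_int_tuple_prob (I : (T -> \bar R) -> \bar R) n (g : n.-tuple T -> \bar R) :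
  (forall F, measurable_fun setT F -> (forall x, 0 <= F x) ->
     I F = \int[P]_x F x) ->
  measurable_fun [set: n.-tuple T] g -> (forall x, 0 <= g x) ->
  iter_int I g = \int[tuple_prob n]_x g x.
Proof.
move=> IP; elim: n g => [|n IHn] g mg g0; first by rewrite integral_tuple_prob0.
rewrite integral_tuple_probS//=.
have -> : (fun x => iter_int I (fun t : n.-tuple T => g (cons_tuple x t))) =
          (fun x => \int[tuple_prob n]_t g (cons_tuple x t)).
  by apply/funext => x; apply: IHn => //; exact: measurable_cons_section.
apply: IP; first exact: measurable_integral_cons.
by move=> x; apply: integral_ge0.
Qed.

(** Coordinates are independent, so the integral of the product factorizes and each factor is at
    most [c]. It bounds volumes of boxes and, later, the Chernoff product over the sample. *)
Lemma integral_tuple_prob_prod n (a : 'I_n -> T -> R) (c : R) :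
  (forall i, measurable_fun setT (a i)) -> (forall i x, (0 <= a i x)%R) ->
  (forall i, \int[P]_x (a i x)%:E <= c%:E) ->
  \int[tuple_prob n]_x (\prod_(i < n) a i (tnth x i))%:E <= (c ^+ n)%:E.
Proof.
elim: n a => [|n IHn] a ma a0 ac.
  have E : (fun x : 0.-tuple T => (\prod_(i < 0) a i (tnth x i))%:E) = cst 1.
    by apply/funext => x; rewrite big_ord0.
  by rewrite E integral_tuple_prob0.
have mprod k (b : 'I_k -> T -> R) : (forall i, measurable_fun setT (b i)) ->
    measurable_fun [set: k.-tuple T] (fun x => \prod_(i < k) b i (tnth x i))%R.
  move=> mb; apply: measurable_prod => i _.
  by apply: measurableT_comp => //; exact: measurable_tnth.
rewrite integral_tuple_probS; last 2 first.
- by apply/measurable_EFinP; exact: mprod.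
- by move=> x; rewrite lee_fin prodr_ge0.
set b := fun i => a (lift ord0 i).
have mb i : measurable_fun setT (b i) by exact: ma.
have c0 : (0 <= c)%R.
  by rewrite -lee_fin (le_trans _ (ac ord0))// integral_ge0// => x _; rewrite lee_fin.
have E x : \int[tuple_prob n]_t (\prod_(i < n.+1) a i (tnth (cons_tuple x t) i))%:E =
    (a ord0 x)%:E * \int[tuple_prob n]_t (\prod_(i < n) b i (tnth t i))%:E.
  rewrite -ge0_integralZl_EFin//.
  - apply: eq_integral => t _; rewrite big_ord_recl tnth0 EFinM; congr (_ * _%:E).
    by apply: eq_bigr => i _; rewrite tnthS.
  - by move=> t _; rewrite lee_fin prodr_ge0// => i _; exact: a0.
  - by apply/measurable_EFinP; exact: mprod.
under eq_integral do rewrite E.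
rewrite ge0_integralZr//; last 3 first.
- by apply/measurable_EFinP; exact: ma.
- by move=> x _; rewrite lee_fin.
- by apply: integral_ge0 => t _; rewrite lee_fin prodr_ge0// => i _; exact: a0.
rewrite exprS EFinM; apply: lee_pmul => //.
- by apply: integral_ge0 => x _; rewrite lee_fin.
- by apply: integral_ge0 => t _; rewrite lee_fin prodr_ge0// => i _; exact: a0.
- by apply: IHn => [i|i x|i]; [exact: ma|exact: a0|exact: ac].
Qed.

Lemma integral_tuple_prob_tnth n (i : 'I_n) (h : T -> \bar R) :
  measurable_fun setT h -> (forall x, 0 <= h x) ->
  \int[tuple_prob n]_x h (tnth x i) = \int[P]_x h x.
Proof.
move=> mh h0; elim: n i => [|n IHn] i; first by case: i.
rewrite integral_tuple_probS//; last first.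
  by apply: measurableT_comp => //; exact: measurable_tnth.
have [->|] := eqVneq i ord0.
  apply: eq_integral => x _; rewrite -[RHS]mule1 -(@probability_setT _ _ _ (tuple_prob n)).
  by rewrite -integral_cst//; apply: eq_integral.
case: (unliftP ord0 i) => [j ->|->]; last by rewrite eqxx.
move=> _; rewrite -[RHS]mule1 -(@probability_setT _ _ _ P) -integral_cst//.
apply: eq_integral => x _; rewrite -(IHn j) /cst.
by apply: eq_integral => t _; rewrite tnthS.
Qed.

(** The comparison is required only on the full-measure set where all coordinates lie in [C];
    induction restricts one coordinate at a time to [C]. *)
Lemma le_integral_tuple_prob n (C : set T) (g h : n.-tuple T -> \bar R) :
  measurable C -> P (~` C) = 0 ->
  measurable_fun [set: n.-tuple T] g -> (forall x, 0 <= g x) ->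
  measurable_fun [set: n.-tuple T] h -> (forall x, 0 <= h x) ->
  (forall x, (forall i, C (tnth x i)) -> g x <= h x) ->
  \int[tuple_prob n]_x g x <= \int[tuple_prob n]_x h x.
Proof.
move=> mC PC; elim: n g h => [|n IHn] g h mg g0 mh h0 gh.
  by rewrite !integral_tuple_prob0//; apply: gh; case.
rewrite !integral_tuple_probS//.
have E (F : T -> \bar R) : measurable_fun setT F -> (forall x, 0 <= F x) ->
    \int[P]_x F x = \int[P]_(x in C) F x.
  move=> mF F0; rewrite (@ge0_negligible_integral _ _ _ P setT (~` C))//.
    by rewrite setTD setCK.
  exact: measurableC.
have ? k (u : k.+1.-tuple T -> \bar R) x : (forall x, 0 <= u x) ->
  0 <= \int[tuple_prob k]_t u (cons_tuple x t) by move=> u0; exact: integral_ge0.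
rewrite !E//; try exact: measurable_integral_cons; auto.
apply: ge0_le_integral => //; auto.
- by apply: measurable_funTS; exact: measurable_integral_cons.
- by apply: measurable_funTS; exact: measurable_integral_cons.
move=> x Cx; apply: IHn => //; try exact: measurable_cons_section.
move=> t Ct; apply: gh => i.
by case: (unliftP ord0 i) => [j ->|->]; rewrite ?tnthS ?tnth0.
Qed.

End IteratedIntegrals.

(** * The uniform law on the unit cube, and Lebesgue-null sets of exceptional coordinates *)

Section UniformCube.
Context {R : realType}.
Implicit Types t s : R.

(** The integral of an arbitrary nonnegative function is a supremum over the simple functions below
    it, and this supremum is monotone. The misclassification indicator is compared through this
    form. *)
Lemma le_integral_ge0 d (T : measurableType d) (m : {measure set T -> \bar R})
    (F G : T -> \bar R) :
  (forall x, (0 <= F x)%E) -> (forall x, (F x <= G x)%E) ->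
  (\int[m]_x F x <= \int[m]_x G x)%E.
Proof.
move=> F0 FG; have G0 x : (0 <= G x)%E by exact: le_trans (FG x).
rewrite !ge0_integralTE//; apply: le_ereal_sup => _ [h /= hF] <-.
by exists h => // x; exact: le_trans (hF x) (FG x).
Qed.

Lemma integral_prob_cst d (T : measurableType d) (P : probability T R) (c : R) :
  (\int[P]_x c%:E = c%:E)%E.
Proof.
rewrite integral_cst// -[RHS]mule1; congr (_ * _)%E.
exact: probability_setT.
Qed.

Lemma intRd_ge0 d (g : d.-tuple R -> \bar R) :
  (forall x, (0 <= g x)%E) -> (0 <= intRd g)%E.
Proof. by move=> g0; apply: iter_int_ge0 => // F F0; exact: integral_ge0. Qed.

Lemma le_intRd d (g h : d.-tuple R -> \bar R) :
  (forall x, (0 <= g x)%E) -> (forall x, (g x <= h x)%E) ->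
  (intRd g <= intRd h)%E.
Proof.
move=> g0 gh; apply: le_iter_int => // F.
  by move=> F0; exact: integral_ge0.
by move=> G F0 FG; exact: le_integral_ge0.
Qed.

Lemma intRd0 d : intRd (fun _ : d.-tuple R => 0%E) = 0%E.
Proof. by apply: iter_int0; exact: integral0. Qed.

(* The library's uniform law lives on a copy of R with another measurability
   display, hence the identity map. *)
Definition of_measurableTypeR : measurableTypeR R -> R := idfun.

Lemma measurable_of_measurableTypeR : measurable_fun setT of_measurableTypeR.
Proof. by move=> _ A mA; rewrite setTI. Qed.

HB.instance Definition _ :=
  @isMeasurableFun.Build _ _ _ _ of_measurableTypeR measurable_of_measurableTypeR.

Definition unif : probability R R :=
  [the probability _ _ of distribution (uniform_prob (@ltr01 R)) of_measurableTypeR].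

Definition in01 t : bool := 0 <= t <= 1.

Lemma in01E t : in01 t = (t \in `[0, 1]%classic).
Proof. by rewrite mem_setE in_itv. Qed.

Lemma integral_unif (F : R -> \bar R) :
  measurable_fun setT F -> (forall x, (0 <= F x)%E) ->
  (\int[unif]_x F x = \int[lebesgue_measure]_(x in `[0%R, 1%R]) F x)%E.
Proof.
move=> mF F0; rewrite (ge0_integral_pushforward measurable_of_measurableTypeR)//.
by rewrite preimage_setT [LHS]integral_uniform// subr0 invr1 mul1e.
Qed.

Lemma unif_setC01 : (unif (~` `[0%R, 1%R]) = 0)%E.
Proof.
rewrite probability_setC//.
have : (\int[unif]_x (\1_`[0%R, 1%R] x)%:E = 1)%E.
  rewrite integral_unif//; last by apply/measurable_EFinP.
  rewrite integral_indic// setIid; etransitivity.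
    exact: (@lebesgue_measure_itv R `[0, 1]).
  by rewrite /= lte_fin ltr01 oppr0 adde0.
by rewrite integral_indic// setIT => ->; rewrite subee.
Qed.

Lemma integral_in01 (F : R -> \bar R) :
  measurable_fun setT F -> (forall x, (0 <= F x)%E) ->
  (\int[lebesgue_measure]_x ((in01 x)%:R%:E * F x) = \int[unif]_x F x)%E.
Proof.
move=> mF F0; rewrite integral_unif// [RHS]integral_mkcond.
apply: eq_integral => x _; rewrite /patch -in01E.
by case: (in01 x); rewrite ?mul1e ?mul0e.
Qed.

Definition cube_density d (x : d.-tuple R) : R :=
  \prod_(i < d) (in01 (tnth x i))%:R.

Definition cube_prob d : probability (d.-tuple R) R := tuple_prob unif d.

Lemma intRd_cube_density d (g : d.-tuple R -> \bar R) :
  measurable_fun [set: d.-tuple R] g -> (forall x, (0 <= g x)%E) ->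
  intRd (fun x => (cube_density x)%:E * g x)%E = (\int[cube_prob d]_x g x)%E.
Proof.
move=> mg g0; rewrite /intRd iter_int_weight; last exact: integral0.
by apply: iter_int_tuple_prob => // F mF F0; exact: integral_in01.
Qed.

Lemma cube_density_ge0 d (x : d.-tuple R) : 0 <= cube_density x.
Proof. by apply: prodr_ge0. Qed.

Lemma cube_densityE d (x : d.-tuple R) :
  cube_density x = [forall i, in01 (tnth x i)]%:R.
Proof.
rewrite /cube_density; case: forallP => [H|/forallP].
  by rewrite big1// => i _; rewrite H.
rewrite negb_forall => /existsP[i /negbTE H].
by rewrite (bigD1 i)//= H mul0r.
Qed.

Lemma measurable_in01 : measurable_fun setT (fun t => (in01 t)%:R : R).
Proof.
rewrite (_ : (fun _ => _) = \1_`[0, 1])//.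
by apply/funext => t; rewrite indicE in01E.
Qed.

Lemma measurable_cube_density d :
  measurable_fun [set: d.-tuple R] (@cube_density d).
Proof.
apply: measurable_prod => i _.
apply: (measurableT_comp measurable_in01); exact: measurable_tnth.
Qed.

Lemma is_density_cube d : is_density (@cube_density d).
Proof.
split; first exact: measurable_cube_density.
split; first exact: cube_density_ge0.
rewrite (_ : (fun x => _) = (fun x => (cube_density x)%:E * cst 1 x)%E); last first.
  by apply/funext => x; rewrite mule1.
rewrite intRd_cube_density//; exact: integral_prob_cst.
Qed.

(** The set is a finite union of preimages of [E] under coordinate maps. By induction, a section at
    a first coordinate in [E] is the whole space, and any other section is the same set in one
    dimension less, hence null. *)
Lemma lebesgue_null_coordinate d (E : set R) :
  measurable E -> lebesgue_measure E = 0%E ->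
  @lebesgue_null R d [set x | exists i, E (tnth x i)].
Proof.
move=> mE E0; eexists; split; last split; [|exact: subset_refl|].
  rewrite (_ : [set x | _] = \bigcup_(i in [set: 'I_d]) ((fun x => tnth x i) @^-1` E)).
    apply: fin_bigcup_measurable => // i _; rewrite -[X in measurable X]setTI.
    exact: measurable_tnth.
  by apply/seteqP; split => x [i]; [exists i|move=> _; exists i].
elim: d => [|d IHd].
  by rewrite /intRd /= indicE memNset// => -[[]].
rewrite /intRd /=.
set F := (X in integral _ _ X).
(* [c] is the measure of the whole space and may be infinite; the convention that 0 times infinity
   is 0 makes both the formula for [F] and its integral correct. *)
pose c := intRd (fun _ : d.-tuple R => 1%E).
suff -> : F = fun x => (c * (\1_E x)%:E)%E.
  have c0 : (0 <= c)%E by exact: intRd_ge0.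
  rewrite ge0_integralZl//; last first.
    by apply/measurable_EFinP; exact: measurable_indic.
  rewrite [X in (_ * X)%E](_ : _ = 0%E) ?mule0//.
  etransitivity; first exact: integral_indic.
  by rewrite setIT; exact: E0.
apply/funext => x; rewrite /F indicE; case: (boolP (x \in E)) => xE.
  rewrite mule1; congr iter_int; apply/funext => t.
  by rewrite indicE mem_set//=; exists ord0; rewrite tnth0; apply/set_mem.
rewrite mule0 -[RHS]IHd; congr iter_int; apply/funext => t.
rewrite !indicE; congr ((_ : bool)%:R%:E); apply/idP/idP; rewrite !inE.
- move=> [i]; case: (unliftP ord0 i) => [j ->|->]; rewrite ?tnthS ?tnth0 => H.
    by exists j.
  by move/negP: xE; case; apply/mem_set.
- by move=> [i Ei]; exists (lift ord0 i); rewrite tnthS.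
Qed.

Lemma norm_le_edist d (x y : d.-tuple R) i :
  `|tnth x i - tnth y i| <= edist x y.
Proof.
rewrite -sqrtr_sqr /edist ler_sqrt; last by apply: sumr_ge0 => j _; exact: sqr_ge0.
by rewrite (bigD1 i)//= lerDl; apply: sumr_ge0 => j _; exact: sqr_ge0.
Qed.

Lemma near_leE (c t : R) : c != t -> \forall s \near t, (c <= s) = (c <= t).
Proof.
move=> ct; case: (ltgtP c t) ct => // h _.
- near=> s; rewrite (_ : c <= s)//; near: s.
  by apply: filterS (lt_nbhsr h) => s /ltW.
- near=> s; apply/negbTE; rewrite -ltNge; near: s.
  exact: lt_nbhsl.
Unshelve. all: by end_near. Qed.

Lemma near_geE (c t : R) : c != t -> \forall s \near t, (s <= c) = (t <= c).
Proof.
move=> ct; case: (ltgtP c t) ct => // h _.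
- near=> s; apply/negbTE; rewrite -ltNge; near: s.
  exact: lt_nbhsr.
- near=> s; rewrite (_ : s <= c)//; near: s.
  by apply: filterS (lt_nbhsl h) => s /ltW.
Unshelve. all: by end_near. Qed.

(** There are finitely many coordinates, so one radius suits them all, and a Euclidean ball lies
    inside the cube of the same radius. *)
Lemma locally_constant_coordinates d (a : R -> bool) (E : set R)
    (x : d.-tuple R) :
  (forall t, ~ E t -> \forall s \near t, a s = a t) ->
  (forall i, ~ E (tnth x i)) ->
  exists2 r : R, 0 < r & forall y, edist x y < r ->
    forall i, a (tnth y i) = a (tnth x i).
Proof.
move=> aE xE.
have : \forall r \near 0^'+, forall i, forall s,
    `|tnth x i - s| < r -> a s = a (tnth x i).
  apply: filter_forall => i.
  have /nbhs_ballP[e e0 He] := aE _ (xE i).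
  near=> r => s sr; apply: He; apply: lt_trans sr _.
  by near: r; exact: nbhs_right_lt.
move=> H.
have [r [r0 Hr]] := filter_ex (filterI (nbhs_right_gt (0 : R)) H).
exists r => // y xy i; apply: Hr; exact: le_lt_trans (norm_le_edist _ _ _) xy.
Unshelve. all: by end_near. Qed.

End UniformCube.

(** * The strip target: measurability, regularity and integration period by period *)

Section Strips.
Context {R : realType}.
Implicit Types (N k : nat) (t : R).

Definition strip N t : bool :=
  [exists k : 'I_N, (k%:R / N%:R <= t) && (t < (k%:R + 8^-1) / N%:R)].

Definition strip_label N n (x : n.+1.-tuple R) : R :=
  if strip N (tnth x ord0) then 1 else -1.

Lemma stripE N k t : (k < N)%N -> k%:R / N%:R <= t -> t < (k.+1)%:R / N%:R ->
  strip N t = (t < (k%:R + 8^-1) / N%:R).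
Proof.
move=> kN kt tk; have N0 : 0 < N%:R^-1 :> R by rewrite invr_gt0 ltr0n (leq_ltn_trans _ kN).
apply/idP/idP => [/existsP[j /andP[jt tj]]|tk8]; last first.
  by apply/existsP; exists (Ordinal kN); rewrite kt tk8.
have : (j < k.+1)%N by rewrite -(ltr_nat R) -(ltr_pM2r N0) (le_lt_trans jt).
have : (k < j.+1)%N.
  rewrite -(ltr_nat R) -(ltr_pM2r N0) (le_lt_trans kt)// (lt_le_trans tj)//.
  by rewrite ler_pM2r// -[j.+1%:R]natr1; lra.
rewrite !ltnS => kj jk.
by rewrite (_ : k = j)//; apply/eqP; rewrite eqn_leq kj jk.
Qed.

Lemma measurable_strip N : measurable [set t | strip N t].
Proof.
rewrite (_ : [set t | _] = \bigcup_(k in [set: 'I_N])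
    `[(k%:R / N%:R : R), (k%:R + 8^-1) / N%:R[%classic).
  by apply: fin_bigcup_measurable.
apply/seteqP; split => t /=.
  by move=> /existsP[k kt]; exists k => //=; rewrite in_itv.
by move=> [k _ /=]; rewrite in_itv => kt; apply/existsP; exists k.
Qed.

Lemma measurable_strip_nat N : measurable_fun [set: R] (fun t => (strip N t)%:R : R).
Proof.
rewrite (_ : (fun _ => _) = \1_[set t | strip N t]).
  by apply: measurable_indic; exact: measurable_strip.
by apply/funext => t; rewrite indicE; congr ((_ : bool)%:R); rewrite mem_setE.
Qed.

Lemma measurable_strip_label N n :
  measurable_fun [set: n.+1.-tuple R] (@strip_label N n).
Proof.
have mS : measurable_fun [set: R] (fun t => if strip N t then 1 else -1 : R).
  apply: measurable_fun_if => //.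
  by apply: (measurable_fun_bool true); rewrite setTI; exact: measurable_strip.
apply: (measurableT_comp mS); exact: measurable_tnth.
Qed.

(** The finitely many points at which [in01] or [strip N] can jump. *)
Definition strip_ends N : seq R :=
  [:: 0; 1] ++ [seq k%:R / N%:R | k : 'I_N] ++ [seq (k%:R + 8^-1) / N%:R | k : 'I_N].

Lemma near_strip N t : ~ [set` strip_ends N] t ->
  \forall s \near t, strip N s = strip N t.
Proof.
rewrite /= !mem_cat => /negP; rewrite !negb_or => /and3P[_ t1 t2].
have H (k : 'I_N) : \forall s \near t,
    (k%:R / N%:R <= s) && (s < (k%:R + 8^-1) / N%:R) =
    (k%:R / N%:R <= t) && (t < (k%:R + 8^-1) / N%:R).
  near=> s; congr (_ && _); first near: s.
    apply: near_leE; apply: contraNneq t1 => <-.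
    by apply/mapP; exists k => //; rewrite mem_enum.
  rewrite !ltNge; congr (~~ _); near: s.
  apply: near_leE; apply: contraNneq t2 => <-.
  by apply/mapP; exists k => //; rewrite mem_enum.
have {}H := filter_forall _ H; near=> s; apply: eq_existsb.
by near: s; exact: H.
Unshelve. all: by end_near. Qed.

Lemma near_in01 N t : ~ [set` strip_ends N] t ->
  \forall s \near t, in01 s = in01 t.
Proof.
rewrite /= !inE => /negP; rewrite !negb_or => /and3P[t0 t1 _].
near=> s; congr (_ && _); near: s.
- by apply: near_leE; rewrite eq_sym.
- by apply: near_geE; rewrite eq_sym.
Unshelve. all: by end_near. Qed.

(** When no coordinate of a point lies in [strip_ends N], both the density and the label are
    constant near it; the remaining points form a null set by [lebesgue_null_coordinate]. *)
Lemma regular_strip_label N n : regular (@cube_density R n.+1) (@strip_label N n).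
Proof.
have sN : countable [set` strip_ends N] by apply: finite_set_countable.
have null : @lebesgue_null R n.+1 [set x | exists i, [set` strip_ends N] (tnth x i)].
  apply: lebesgue_null_coordinate; last exact: countable_lebesgue_measure0.
  by apply: countable_measurable => // t; exact: measurable_set1.
have sub (A : set (n.+1.-tuple R)) :
    (forall x, (forall i, ~ [set` strip_ends N] (tnth x i)) -> ~ A x) -> lebesgue_null A.
  move=> HA; have [B [mB [EB B0]]] := null; exists B; split => //; split => // x Ax.
  by apply: EB => /=; apply: contrapT => /forallNP /HA.
split; apply: sub => x Hx nP; apply: nP.
- have [r r0 Hr] := locally_constant_coordinates (@near_in01 N) Hx.
  move=> e e0; exists r => // y /Hr xy.
  by rewrite /cube_density; under eq_bigr do rewrite xy; rewrite subrr normr0.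
- have [r r0 Hr] := locally_constant_coordinates (@near_strip N) Hx.
  by exists r => // y /Hr xy; rewrite /strip_label xy.
Qed.

Lemma le_integral_itv_cst (h : R -> \bar R) (u v a : R) :
  measurable_fun setT h -> (forall t, 0 <= h t)%E -> u <= v -> 0 <= a ->
  (forall t, u <= t < v -> (h t <= a%:E)%E) ->
  (\int[lebesgue_measure]_(t in `[u, v[) h t <= (a * (v - u))%:E)%E.
Proof.
move=> mh h0 uv a0 ha.
apply: (@le_trans _ _ (\int[lebesgue_measure]_(t in `[u, v[) a%:E)%E).
  apply: ge0_le_integral => //.
  exact: measurable_funTS.
rewrite integral_cst// EFinM; apply: lee_pmul => //.
rewrite [leLHS](_ : _ = lebesgue_measure `[u, v[%classic)//.
rewrite (@lebesgue_measure_itv R `[u, v[)/=.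
by case: ifPn => // _; rewrite lee_fin subr_ge0.
Qed.

Lemma integral_itv_cat (h : R -> \bar R) (u v w : R) :
  measurable_fun setT h -> (forall t, 0 <= h t)%E -> u <= v -> v <= w ->
  (\int[lebesgue_measure]_(t in `[u, w[) h t =
   \int[lebesgue_measure]_(t in `[u, v[) h t +
   \int[lebesgue_measure]_(t in `[v, w[) h t)%E.
Proof.
move=> mh h0 uv vw; rewrite -ge0_integral_setU//.
- by rewrite -itv_bndbnd_setU.
- exact: measurable_funTS.
- apply/disj_setPS => t /= []; rewrite !in_itv/= => /andP[_ tv] /andP[vt _].
  by move: (lt_le_trans tv vt); rewrite ltxx.
Qed.

(** Each period of length [1/N] splits into a strip of length [1/(8N)], where [h] is at most [a k],
    and a rest of length [7/(8N)], where it is at most [b k]. Its contribution is thus at most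
    [c/N], and there are [N] periods. *)
Lemma le_integral_strip N (h : R -> \bar R) (a b : nat -> R) (c : R) :
  (0 < N)%N -> measurable_fun setT h -> (forall t, 0 <= h t)%E ->
  (forall k, 0 <= a k) -> (forall k, 0 <= b k) ->
  (forall k, (k < N)%N -> a k * 8^-1 + b k * (7 / 8) <= c) ->
  (forall k t, (k < N)%N -> k%:R / N%:R <= t -> t < (k.+1)%:R / N%:R ->
     (h t <= (if strip N t then a k else b k)%:E)%E) ->
  (\int[unif]_t h t <= c%:E)%E.
Proof.
move=> N0 mh h0 a0 b0 abc hab; rewrite integral_unif//.
have NR : 0 < N%:R :> R by rewrite ltr0n.
(* The endpoint 1 is dropped so that half-open periods tile the interval; the induction then runs on
   the number of periods. *)
rewrite -integral_itv_bndo_bndc; last exact: measurable_funTS.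
suff H K : (K <= N)%N ->
    (\int[lebesgue_measure]_(t in `[0%R, (K%:R / N%:R)%R[) h t <= (c * (K%:R / N%:R))%:E)%E.
  by have := H N (leqnn N); rewrite divff ?mulr1// gt_eqF.
elim: K => [_|K IHK KN]; first by rewrite mul0r mulr0 set_itvco0 integral_set0.
pose m := (K%:R + 8^-1) / N%:R : R.
have KNm : K%:R / N%:R <= m by rewrite ler_pM2r ?invr_gt0//; lra.
have mKN : m <= K.+1%:R / N%:R by rewrite ler_pM2r ?invr_gt0// -[K.+1%:R]natr1; lra.
rewrite (@integral_itv_cat _ _ (K%:R / N%:R))//; last exact: le_trans mKN.
rewrite (@integral_itv_cat _ (K%:R / N%:R) m)//.
have I1 : (\int[lebesgue_measure]_(t in `[(K%:R / N%:R)%R, m[) h t <=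
    (a K * (m - K%:R / N%:R))%:E)%E.
  apply: le_integral_itv_cst => // t /andP[t1 t2].
  have := hab K t KN t1 (lt_le_trans t2 mKN).
  by rewrite (stripE KN)// ?t2// (lt_le_trans t2 mKN).
have I2 : (\int[lebesgue_measure]_(t in `[m, (K.+1%:R / N%:R)%R[) h t <=
    (b K * (K.+1%:R / N%:R - m))%:E)%E.
  apply: le_integral_itv_cst => // t /andP[t1 t2].
  have := hab K t KN (le_trans KNm t1) t2.
  by rewrite (stripE KN)// ?(le_trans KNm t1)// ltNge t1.
apply: (le_trans (leeD (IHK (ltnW KN)) (leeD I1 I2))).
rewrite -!EFinD lee_fin.
have -> : m - K%:R / N%:R = 8^-1 / N%:R by rewrite /m; field; rewrite gt_eqF.
have -> : K.+1%:R / N%:R - m = 7 / 8 / N%:R.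
  by rewrite /m -[K.+1%:R]natr1; field; rewrite gt_eqF.
have -> : c * (K.+1%:R / N%:R) = c * (K%:R / N%:R) + c / N%:R.
  by rewrite -[K.+1%:R]natr1; field; rewrite gt_eqF.
rewrite lerD2l !mulrA -mulrDl ler_pM2r ?invr_gt0//.
by have := abc K KN; rewrite !mulrA.
Qed.

End Strips.

(** * Splitting the kernel into a bounded far part and an integrable near part *)

Section Kernels.
Context {R : realType}.
Variable beta : R.
Hypothesis beta_gt0 : 0 < beta.

Lemma edist_nneg n (x y : n.-tuple R) : 0 <= edist x y.
Proof. exact: sqrtr_ge0. Qed.

Lemma measurable_edist d (T : measurableType d) n (u v : T -> n.-tuple R) :
  measurable_fun setT u -> measurable_fun setT v ->
  measurable_fun setT (fun z => edist (u z) (v z)).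
Proof.
move=> mu mv; have ms : measurable_fun setT (Num.sqrt : R -> R).
  by apply: continuous_measurable_fun; exact: sqrt_continuous.
apply: (measurableT_comp ms); apply: measurable_sum => i.
apply: measurable_funX; apply: measurable_funB.
- exact: (measurableT_comp (measurable_tnth i) mu).
- exact: (measurableT_comp (measurable_tnth i) mv).
Qed.

(* The kernel capped at distance [2 ^- K]; the remaining singular part is
   dominated by the dyadic series below. *)
Definition far_kernel K n (x y : n.-tuple R) : R :=
  Num.max (edist x y) (2 ^- K) `^ (- beta).

(** The value of the kernel at distance [2 ^- k.+1], carried by the sup-norm ball of radius
    [2 ^- k]. The sup norm makes the indicator a product over coordinates. *)
Definition dyadic_term k n (x y : n.-tuple R) : R :=
  (2 `^ beta) ^+ k.+1 * \prod_(i < n) (`|tnth x i - tnth y i| < 2 ^- k)%R%:R.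

Definition near_kernel K n (x y : n.-tuple R) : \bar R :=
  (\sum_(k <oo) (dyadic_term (K + k) x y)%:E)%E.

Lemma powRN_le (u v : R) : 0 < u -> u <= v -> v `^ (- beta) <= u `^ (- beta).
Proof.
move=> u0 uv; rewrite !powRN lef_pV2 ?posrE ?powR_gt0//; last exact: lt_le_trans uv.
by apply: ge0_ler_powR => //; rewrite ?nnegrE ltW// (lt_le_trans u0).
Qed.

Lemma powRN_dyadic k : (2 ^- k) `^ (- beta) = (2 `^ beta) ^+ k :> R.
Proof.
rewrite powRN -[2 ^- k]powR_invn// -powRrM mulrC powRrM powR_invn ?powR_ge0//.
by rewrite invrK.
Qed.

Lemma powR2_ge1 : 1 <= 2 `^ beta :> R.
Proof. by rewrite -[leLHS](powRr0 2); apply: ler_powR; rewrite ?ler1n// ltW. Qed.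

Lemma dyadic_gt0 k : 0 < 2 ^- k :> R.
Proof. by rewrite invr_gt0 exprn_gt0. Qed.

Lemma far_kernel_gt0 K n (x y : n.-tuple R) : 0 < far_kernel K x y.
Proof. by rewrite powR_gt0// lt_max dyadic_gt0 orbT. Qed.

Lemma far_kernel_le K n (x y : n.-tuple R) : far_kernel K x y <= (2 `^ beta) ^+ K.
Proof.
rewrite -powRN_dyadic; apply: powRN_le; first exact: dyadic_gt0.
by rewrite le_max lexx orbT.
Qed.

Lemma measurable_far_kernel d (T : measurableType d) K n (u v : T -> n.-tuple R) :
  measurable_fun setT u -> measurable_fun setT v ->
  measurable_fun setT (fun z => far_kernel K (u z) (v z)).
Proof.
move=> mu mv; apply: (measurableT_comp (measurable_powR (- beta))).
by apply: measurable_maxr => //; exact: measurable_edist.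
Qed.

Lemma dyadic_term_ge0 k n (x y : n.-tuple R) : 0 <= dyadic_term k x y.
Proof. by rewrite mulr_ge0// ?exprn_ge0 ?powR_ge0// prodr_ge0. Qed.

Lemma measurable_dyadic_term d (T : measurableType d) k n (u v : T -> n.-tuple R) :
  measurable_fun setT u -> measurable_fun setT v ->
  measurable_fun setT (fun z => dyadic_term k (u z) (v z)).
Proof.
move=> mu mv; apply: measurable_funM => //; apply: measurable_prod => i _.
have mI : measurable_fun setT (fun t : R => (t < 2 ^- k)%R%:R : R).
  rewrite (_ : (fun _ => _) = \1_`]-oo, 2 ^- k[).
    by apply: measurable_indic.
  by apply/funext => t; rewrite indicE mem_setE in_itv.
apply: (measurableT_comp mI); apply: measurableT_comp => //; apply: measurable_funB.
- exact: (measurableT_comp (measurable_tnth i) mu).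
- exact: (measurableT_comp (measurable_tnth i) mv).
Qed.

Lemma near_kernel_ge0 K n (x y : n.-tuple R) : (0 <= near_kernel K x y)%E.
Proof. by apply: nneseries_ge0 => k _ _; rewrite lee_fin dyadic_term_ge0. Qed.

Lemma measurable_near_kernel d (T : measurableType d) K n (u v : T -> n.-tuple R) :
  measurable_fun setT u -> measurable_fun setT v ->
  measurable_fun setT (fun z => near_kernel K (u z) (v z)).
Proof.
move=> mu mv; apply: ge0_emeasurable_sum => k.
  by move=> z _ _; rewrite lee_fin dyadic_term_ge0.
by move=> _; apply/measurable_EFinP; exact: measurable_dyadic_term.
Qed.

Lemma near_kernel_ge K n (x y : n.-tuple R) m :
  (\sum_(0 <= k < m) (dyadic_term (K + k) x y)%:E <= near_kernel K x y)%E.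
Proof. by apply: nneseries_lim_ge => k _ _; rewrite lee_fin dyadic_term_ge0. Qed.

(** On the diagonal every dyadic term is at least 1, so the series diverges. This later rules out a
    test point that coincides with a sample point. *)
Lemma near_kernel_diag K n (x : n.-tuple R) m : (m%:R%:E <= near_kernel K x x)%E.
Proof.
apply: le_trans (near_kernel_ge K x x m).
rewrite sumEFin lee_fin -[m in m%:R]subn0 -sumr_const_nat.
apply: ler_sum => k _; rewrite /dyadic_term big1.
  by rewrite mulr1 exprn_ege1// powR2_ge1.
by move=> i _; rewrite subrr normr0 dyadic_gt0.
Qed.

(** Take the least [j] with [2 ^- j <= z]; it exceeds [K], and [k] is its predecessor. *)
Lemma dyadic_scale (z : R) K : 0 < z -> z < 2 ^- K ->
  exists2 k, (K <= k)%N & 2 ^- k.+1 <= z < 2 ^- k.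
Proof.
move=> z0 zK.
have [j Hj] : exists j, 2 ^- j <= z.
  exists (Num.trunc z^-1).+1; rewrite -[leRHS]invrK lef_pV2 ?posrE ?invr_gt0// ?exprn_gt0//.
  apply: (le_trans (ltW (truncnS_gt _))).
  by rewrite -natrX ler_nat ltnW// ltn_expl.
have [k Hk kmin] := ex_minnP (ex_intro (fun j => 2 ^- j <= z) j Hj).
have Kk : (K < k)%N.
  rewrite ltnNge; apply/negP => kK.
  have : 2 ^- K <= 2 ^- k :> R.
    by rewrite lef_pV2 ?posrE ?exprn_gt0// ler_eXn2l ?ltr1n.
  by move=> /le_lt_trans /(_ (le_lt_trans Hk zK)); rewrite ltxx.
case: k => // k in Hk kmin Kk *; exists k => //; rewrite Hk/= ltNge.
by apply/negP => /kmin; rewrite ltnn.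
Qed.

(** Beyond distance [2 ^- K] the cap is inactive and the difference vanishes. Closer in, the single
    dyadic term at the scale of the distance already dominates. *)
Lemma kernel_split K n (x y : n.-tuple R) :
  (`|edist x y `^ (- beta) - far_kernel K x y|%:E <= near_kernel K x y)%E.
Proof.
have [xyK|xyK] := leP (2 ^- K) (edist x y).
  by rewrite /far_kernel max_l// subrr normr0 near_kernel_ge0.
have far : far_kernel K x y = (2 `^ beta) ^+ K.
  by rewrite /far_kernel max_r ?(ltW xyK)// powRN_dyadic.
have term k : (K <= k)%N -> edist x y < 2 ^- k ->
    (((2 `^ beta) ^+ k.+1)%:E <= near_kernel K x y)%E.
  move=> Kk xyk; have <- : dyadic_term k x y = (2 `^ beta) ^+ k.+1.
    rewrite /dyadic_term big1 ?mulr1// => i _.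
    by rewrite (le_lt_trans (norm_le_edist _ _ _) xyk).
  apply: le_trans (near_kernel_ge K x y (k - K).+1).
  rewrite big_nat_recr//= subnKC// sumEFin -EFinD lee_fin lerDr.
  by apply: sumr_ge0 => *; exact: dyadic_term_ge0.
have := edist_nneg x y; rewrite le_eqVlt => /predU1P[xy0|xy0].
  (* At distance zero the negative power takes the value 0, so the difference is the cap itself,
     which the term of index [K] dominates. *)
  rewrite -xy0 powR0 ?oppr_eq0 ?gt_eqF// sub0r normrN far.
  apply: le_trans (term K (leqnn K) xyK).
  rewrite lee_fin ger0_norm ?exprn_ge0 ?powR_ge0// exprS ler_peMl ?powR2_ge1//.
have [k Kk /andP[kxy xyk]] := dyadic_scale xy0 xyK.
apply: le_trans (term k Kk xyk).
rewrite lee_fin ger0_norm; last first.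
  by rewrite subr_ge0; apply: powRN_le => //; rewrite le_max lexx.
rewrite lerBlDr (@le_trans _ _ ((2 `^ beta) ^+ k.+1))//.
  by rewrite -powRN_dyadic; apply: powRN_le => //; exact: dyadic_gt0.
by rewrite lerDl ltW// far_kernel_gt0.
Qed.

Lemma integral_unif_ball (c r : R) : 0 < r ->
  (\int[unif]_t (`|c - t| < r)%R%:R%:E <= (2 * r)%:E)%E.
Proof.
move=> r0.
have E : (fun t : R => (`|c - t| < r)%R%:R) = \1_(`]c - r, c + r[%classic) :> (R -> R).
  by apply/funext => t; rewrite indicE mem_setE in_itv/= distrC ltr_distl.
rewrite integral_unif; last 2 first.
- by apply/measurable_EFinP; rewrite E; exact: measurable_indic.
- by move=> t; rewrite lee_fin.
apply: (@le_trans _ _ (\int[lebesgue_measure]_t (\1_(`]c - r, c + r[%classic) t)%:E)%E).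
  rewrite integral_mkcond; apply: le_integral_ge0 => t.
    by rewrite /patch; case: ifP => // _; rewrite lee_fin.
  rewrite -[\1__]E /patch; case: ifP => // _; by rewrite lee_fin.
rewrite integral_indic// setIT.
rewrite [leLHS](_ : _ = lebesgue_measure `]c - r, c + r[%classic)//.
rewrite (@lebesgue_measure_itv R `]c - r, c + r[)/=.
by case: ifPn => _; rewrite -?EFinB lee_fin; lra.
Qed.

(** With [b = 2 ^ beta] and [r = b / 2 ^ n], the term of index [K + k] has integral at most
    [b ^ (K+k+1)] times the box volume [(2 * 2 ^- (K+k)) ^ n], that is [b * 2 ^ n * r ^ (K+k)]. The
    series is geometric, with [r < 1] precisely because [beta < n]. *)
Lemma integral_near_kernel K n (x : n.-tuple R) : beta < n%:R ->
  (\int[cube_prob n]_y near_kernel K x y <=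
   (2 `^ beta * 2 ^+ n * (2 `^ beta / 2 ^+ n) ^+ K / (1 - 2 `^ beta / 2 ^+ n))%:E)%E.
Proof.
move=> bn; set b := 2 `^ beta; set r := b / 2 ^+ n.
have b0 : 0 < b by exact: powR_gt0.
have r0 : 0 < r by rewrite divr_gt0// exprn_gt0.
have r1 : r < 1.
  rewrite ltr_pdivrMr ?exprn_gt0// mul1r -powR_mulrn// /b /powR.
  by rewrite !gt_eqF// ltr_expR ltr_pM2r// ln_gt0// ltr1n.
rewrite /near_kernel integral_nneseries//; last 2 first.
- by move=> k; apply/measurable_EFinP; exact: measurable_dyadic_term.
- by move=> k y _; rewrite lee_fin dyadic_term_ge0.
have step k : (\int[cube_prob n]_y (dyadic_term (K + k) x y)%:E <=
    (b * 2 ^+ n * r ^+ K * r ^+ k)%:E)%E.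
  have mI i : measurable_fun setT
      (fun t : R => (`|tnth x i - t| < 2 ^- (K + k))%R%:R : R).
    rewrite (_ : (fun _ => _) = \1_(`]tnth x i - 2 ^- (K + k), tnth x i + 2 ^- (K + k)[%classic)).
      exact: measurable_indic.
    by apply/funext => t; rewrite indicE mem_setE in_itv/= distrC ltr_distl.
  under eq_integral do rewrite /dyadic_term EFinM.
  rewrite ge0_integralZl_EFin => [|//|y _||]; last 3 first.
  - by rewrite lee_fin prodr_ge0.
  - apply/measurable_EFinP; apply: measurable_prod => i _.
    exact: (measurableT_comp (mI i) (measurable_tnth i)).
  - by rewrite exprn_ge0// ltW.
  apply: (@le_trans _ _ ((b ^+ (K + k).+1)%:E * ((2 * 2 ^- (K + k)) ^+ n)%:E)%E).
    apply: lee_pmul => //.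
      by apply: integral_ge0 => y _; rewrite lee_fin prodr_ge0.
    apply: (@integral_tuple_prob_prod _ _ _ unif n
      (fun i t => (`|tnth x i - t| < 2 ^- (K + k))%R%:R)) => // i.
    exact/integral_unif_ball/dyadic_gt0.
  rewrite -EFinM lee_fin -[_ * r ^+ K * _]mulrA -exprD /r !exprMn !exprVn.
  by rewrite -!exprM mulnC exprS mulrACA !mulrA.
apply: lime_le.
  by apply: is_cvg_nneseries => k _ _; apply: integral_ge0 => y _; rewrite lee_fin dyadic_term_ge0.
near=> m; apply: (@le_trans _ _ (\sum_(0 <= k < m) (b * 2 ^+ n * r ^+ K * r ^+ k)%:E)%E).
  by apply: lee_sum => k _; exact: step.
rewrite sumEFin lee_fin; apply: geometric_le_lim => //.
  by rewrite !mulr_ge0// ?exprn_ge0// ltW.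
by rewrite gtr0_norm.
Unshelve. all: by end_near. Qed.

End Kernels.

(** * The exponential moment of the capped vote *)

Section Chernoff.
Context {R : realType}.
Variable beta : R.
Hypothesis beta_gt0 : 0 < beta.

(** Inverting [expR (- u) >= 1 - u] leaves [1 <= (1 - u) * (1 + u + 2 * u ^+ 2)], whose right side
    is [1 + u ^+ 2 * (1 - 2 * u)]. *)
Lemma expR_le_quadratic (u : R) : u <= 2^-1 -> expR u <= 1 + u + 2 * u ^+ 2.
Proof.
move=> u2; have u1 : 0 < 1 - u by lra.
rewrite -[u in expR u]opprK expRN; apply: (@le_trans _ _ (1 - u)^-1).
  by rewrite lef_pV2 ?posrE ?expR_gt0// expR_ge1Dx.
rewrite -[leRHS]mulr1 -[leLHS]mul1r ler_pdivrMr// mulr1.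
by have := sqr_ge0 u; nra.
Qed.

(** The last hypothesis on [lam] absorbs the quadratic remainder into one extra [lam * tau], so the
    bound is affine in the sign [e]. *)
Lemma expR_signed_le (lam tau e g G : R) : 0 <= lam -> 0 < tau ->
  (e = 1 \/ e = -1) -> 0 < g -> g <= G ->
  lam * (G + tau) <= 2^-1 -> 2 * (lam * (G + tau)) ^+ 2 <= lam * tau ->
  expR (lam * (e * g + tau)) <= 1 + lam * (e * g + tau) + lam * tau.
Proof.
move=> lam0 tau0 He g0 gG lamB lamB2.
have lg : 0 <= lam * g by rewrite mulr_ge0// ltW.
have lt : 0 <= lam * tau by rewrite mulr_ge0// ltW.
have lgB : lam * g + lam * tau <= lam * (G + tau).
  by rewrite -mulrDr ler_wpM2l// lerD2r.
have uB : `|lam * (e * g + tau)| <= lam * (G + tau).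
  rewrite mulrDr mulrCA ler_norml; move: lg lt lgB; clear -He.
  by move: (lam * g) (lam * tau) (lam * _) => a b c; case: He => ->; lra.
apply: (le_trans (expR_le_quadratic _)).
  exact: le_trans (ler_norm _) (le_trans uB lamB).
rewrite lerD2l; apply: le_trans lamB2; rewrite ler_pM2l//.
by rewrite -(real_normK (num_real (lam * (e * _ + _)))) ler_pXn2r// nnegrE (le_trans _ uB).
Qed.

Lemma edist_cons_le n (x : n.+1.-tuple R) (y : n.-tuple R) (s t : R) :
  edist x (cons_tuple s y) <= edist x (cons_tuple t y) + `|t - s|.
Proof.
have e0 r : 0 <= edist x (cons_tuple r y) by exact: edist_nneg.
have xt : `|tnth x ord0 - t| <= edist x (cons_tuple t y).
  by have := norm_le_edist x (cons_tuple t y) ord0; rewrite tnth0.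
have E r : edist x (cons_tuple r y) ^+ 2 = (tnth x ord0 - r) ^+ 2 +
    \sum_(i < n) (tnth x (lift ord0 i) - tnth y i) ^+ 2.
  rewrite sqr_sqrtr; last by apply: sumr_ge0 => i _; exact: sqr_ge0.
  by rewrite big_ord_recl tnth0; congr (_ + _); apply: eq_bigr => i _; rewrite tnthS.
rewrite -(@ler_pXn2r _ 2)// ?nnegrE ?addr_ge0//.
have H : (tnth x ord0 - t) * (t - s) <= edist x (cons_tuple t y) * `|t - s|.
  by rewrite (le_trans (ler_norm _))// normrM ler_wpM2r.
rewrite sqrrD !E real_normK ?num_real//.
move: (\sum_(i < n) _) (edist _ _ * _) H => S h H; nra.
Qed.

(** The capped distance is at least [2 ^- K], so a shift of the first coordinate by at most [1/N]
    multiplies it by at most [1 + 2 ^+ K / N], and the kernel changes by a factor of at most 2. *)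
Lemma far_kernel_cons_le K N n (x : n.+1.-tuple R) (y : n.-tuple R) (s t : R) :
  (1 + 2 ^+ K / N%:R) `^ beta <= 2 -> `|t - s| <= N%:R^-1 ->
  far_kernel beta K x (cons_tuple t y) <= 2 * far_kernel beta K x (cons_tuple s y).
Proof.
move=> hN ts; rewrite /far_kernel.
set rho : R := 2 ^- K; have rho0 : 0 < rho by exact: dyadic_gt0.
set et := Num.max _ _; set es := Num.max (edist x (cons_tuple s y)) _.
have et0 : 0 < et by rewrite lt_max rho0 orbT.
have es0 : 0 < es by rewrite lt_max rho0 orbT.
have c0 : 0 < 1 + 2 ^+ K / N%:R :> R.
  by rewrite ltr_pwDl// divr_ge0// exprn_ge0.
have H : es <= et * (1 + 2 ^+ K / N%:R).
  have rt : rho <= et by rewrite le_max lexx orbT.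
  have K0 : 1 <= et * 2 ^+ K.
    rewrite -ler_pdivrMr ?exprn_gt0//; rewrite mul1r; exact: rt.
  have H1 : N%:R^-1 <= et * (2 ^+ K / N%:R) :> R.
    by rewrite mulrA ler_peMl// invr_ge0.
  rewrite mulrDr mulr1 ge_max; apply/andP; split.
    apply: (le_trans (edist_cons_le x y s t)); apply: lerD.
      by rewrite le_max lexx.
    exact: le_trans ts H1.
  by rewrite -[leLHS]addr0 lerD// (le_trans _ H1)// invr_ge0.
have := powRN_le beta_gt0 es0 H; rewrite (powRM _ (ltW et0) (ltW c0)) => H2.
have H3 : et `^ (- beta) * 2^-1 <= es `^ (- beta).
  apply: le_trans H2; apply: ler_wpM2l; first exact: powR_ge0.
  by rewrite powRN lef_pV2 ?posrE ?powR_gt0.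
by lra.
Qed.

(** The cube has diameter [Num.sqrt n.+1], and the cap [2 ^- K] is at most 1. *)
Lemma far_kernel_ge K n (x y : n.+1.-tuple R) :
  (forall i, in01 (tnth x i)) -> (forall i, in01 (tnth y i)) ->
  Num.sqrt n.+1%:R `^ (- beta) <= far_kernel beta K x y.
Proof.
move=> x01 y01; apply: powRN_le => //; first by rewrite lt_max dyadic_gt0 orbT.
rewrite ge_max; apply/andP; split.
  rewrite ler_sqrt// -[n.+1 in leRHS]card_ord -sumr_const ler_sum// => i _.
  have /andP[x0 x1] := x01 i; have /andP[y0 y1] := y01 i.
  by rewrite -ler_sqrt// sqrtr_sqr sqrtr1 ler_norml; lra.
rewrite (@le_trans _ _ 1)//.
  by rewrite invf_le1 ?exprn_gt0// exprn_ege1// ler1n.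
by rewrite -[leLHS]sqrtr1 ler_sqrt// ler1n.
Qed.

(** The expectation, over the noise in the label of [y], of the exponential of [lam] times the
    capped vote of [y] shifted by [tau]. *)
Definition chernoff_weight n (f : n.+1.-tuple R -> R) (p lam tau : R) K
    (x y : n.+1.-tuple R) : R :=
  (1 - p) * expR (lam * (f y * far_kernel beta K x y + tau)) +
  p * expR (lam * (- f y * far_kernel beta K x y + tau)).

Lemma measurable_chernoff_weight d (T : measurableType d) n f p lam tau K
    (u v : T -> n.+1.-tuple R) :
  measurable_fun [set: n.+1.-tuple R] f ->
  measurable_fun setT u -> measurable_fun setT v ->
  measurable_fun setT (fun z => chernoff_weight f p lam tau K (u z) (v z)).
Proof.
move=> mf mu mv; have mfar := measurable_far_kernel beta K mu mv.
have mfv := measurableT_comp mf mv.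
apply: measurable_funD; apply: measurable_funM => //; apply: measurableT_comp => //;
  apply: measurable_funM => //; apply: measurable_funD => //; apply: measurable_funM => //.
exact: measurableT_comp.
Qed.

(** With the other coordinates of [y] fixed, the kernel stays within a factor 2 of a constant on
    each period. The seven eighths labelled -1 therefore outvote the strip even after the noise
    shrinks the mean vote by [1 - 2 * p]. *)
Lemma integral_chernoff_weight n K N (p lam tau : R) (x : n.+1.-tuple R) :
  (forall i, in01 (tnth x i)) -> 0 < p -> p < 49 / 100 ->
  tau = Num.sqrt n.+1%:R `^ (- beta) / 25 / 40 ->
  (0 < N)%N -> (1 + 2 ^+ K / N%:R) `^ beta <= 2 ->
  0 <= lam -> lam * ((2 `^ beta) ^+ K + tau) <= 2^-1 ->
  2 * (lam * ((2 `^ beta) ^+ K + tau)) ^+ 2 <= lam * tau ->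
  (\int[cube_prob n.+1]_y
     (chernoff_weight (@strip_label R N n) p lam tau K x y)%:E <=
   (1 - lam * tau)%:E)%E.
Proof.
move=> x01 p0 p1 tauE N0 hN lam0 lamB lamB2.
set B := (2 `^ beta) ^+ K + tau in lamB lamB2.
set f := @strip_label R N n.
have NR : 0 < N%:R :> R by rewrite ltr0n.
have tau0 : 0 < tau.
  by rewrite tauE !divr_gt0// powR_gt0// sqrtr_gt0 ltr0n.
have lt1 : lam * tau <= 2^-1.
  apply: le_trans lamB; apply: ler_wpM2l => //.
  by rewrite lerDr exprn_ge0// powR_ge0.
have psi0 u v : 0 <= chernoff_weight f p lam tau K u v.
  by rewrite addr_ge0// mulr_ge0 ?expR_ge0//; lra.
have psiE0 y : (0 <= (chernoff_weight f p lam tau K x y)%:E)%E by rewrite lee_fin.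
have mpsi : measurable_fun [set: n.+1.-tuple R]
    (fun y => (chernoff_weight f p lam tau K x y)%:E).
  apply/measurable_EFinP; apply: measurable_chernoff_weight => //.
  exact: measurable_strip_label.
have expB (e g : R) : (e = 1 \/ e = -1) -> 0 < g -> g <= (2 `^ beta) ^+ K ->
    expR (lam * (e * g + tau)) <= 1 + lam * (e * g + tau) + lam * tau.
  by move=> He g0 gB; exact: expR_signed_le lamB lamB2.
(* The first coordinate, along which the strips alternate, becomes the inner variable. *)
rewrite integral_tuple_prob_swap//.
rewrite -[leRHS](integral_prob_cst (tuple_prob unif n)).
apply: (@le_integral_tuple_prob _ _ _ unif n `[0, 1]%classic) => //.
- exact: unif_setC01.
- exact: (measurable_integral_cons_swap unif mpsi psiE0).
- by move=> y; apply: integral_ge0 => t _; rewrite lee_fin.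
- by move=> y; rewrite lee_fin; lra.
move=> y y01.
pose c k := far_kernel beta K x (cons_tuple (k%:R / N%:R) y).
have cB k : 0 < c k <= (2 `^ beta) ^+ K.
  by rewrite far_kernel_gt0 far_kernel_le.
(* The kernel is replaced by [2 * c k] on the strip and by [c k / 2] off it, the unfavourable choice
   in both cases. *)
apply: (@le_integral_strip _ N _
  (fun k => 1 + lam * ((1 - 2 * p) * (2 * c k) + tau) + lam * tau)
  (fun k => 1 + lam * (- ((1 - 2 * p) * (c k / 2)) + tau) + lam * tau)) => //.
- by apply: (measurableT_comp mpsi); apply: measurable_cons.
- move=> k; have /andP[ck _] := cB k.
  have : 0 <= (1 - 2 * p) * (2 * c k) by rewrite mulr_ge0//; lra.
  have : 0 <= lam * tau by rewrite mulr_ge0// ltW.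
  by move=> *; rewrite !addr_ge0// mulr_ge0// addr_ge0// ltW.
- move=> k; have /andP[ck0 ckB] := cB k.
  have lc : lam * c k <= 2^-1.
    apply: le_trans lamB; apply: ler_wpM2l => //; rewrite /B; lra.
  have lc0 : 0 <= lam * c k by rewrite mulr_ge0// ltW.
  have lt : 0 <= lam * tau by rewrite mulr_ge0// ltW.
  nra.
(* The mean of the two bounds is [1 + 2 * lam * tau] minus 3/16 of [lam * (1 - 2 * p) * c k],
   because 2/8 - 7/16 = -3/16. As 20 * 3/16 > 3, the lower bound [20 * tau] below suffices. *)
- move=> k kN; have /andP[ck0 ckB] := cB k.
  have ca : tau * 40 * 25 <= c k.
    rewrite tauE !divfK//; apply: far_kernel_ge => // i.
    case: (unliftP ord0 i) => [j ->|->]; rewrite ?tnthS ?tnth0.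
      by rewrite in01E mem_set//; exact: y01.
    by rewrite /in01 divr_ge0//= ler_pdivrMr// mul1r ler_nat ltnW.
  (* The factor 1000 in [tau] is spent here: [1 - 2 * p > 1/50] and 1000 / 50 = 20. *)
  have H : 20 * tau <= (1 - 2 * p) * c k.
    apply: (@le_trans _ _ (50^-1 * c k)); first by lra.
    by rewrite ler_wpM2r ?ltW//; lra.
  have : 0 <= lam * ((1 - 2 * p) * c k - 20 * tau) by rewrite mulr_ge0// subr_ge0.
  have lt : 0 <= lam * tau by rewrite mulr_ge0// ltW.
  nra.
move=> k t kN kt tk; rewrite lee_fin.
set g := far_kernel beta K x (cons_tuple t y).
have g0 : 0 < g by exact: far_kernel_gt0.
have gB : g <= (2 `^ beta) ^+ K by exact: far_kernel_le.
have tkN : `|t - k%:R / N%:R| <= N%:R^-1.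
  rewrite ger0_norm ?subr_ge0// lerBlDl (le_trans (ltW tk))//.
  by rewrite -[k.+1%:R]natr1 mulrDl mul1r.
have gc : g <= 2 * c k by exact: (far_kernel_cons_le x y hN tkN).
have cg : c k <= 2 * g by apply: (far_kernel_cons_le x y hN); rewrite distrC.
rewrite /chernoff_weight /f /strip_label tnth0 -/g.
(* Both bounds are affine in the label, so averaging over the noise replaces the label by plus or
   minus [1 - 2 * p]. *)
have E1 := expB 1 g (or_introl erefl) g0 gB.
have E2 := expB (-1) g (or_intror erefl) g0 gB.
have p01 : 0 <= 1 - p by lra.
have q1 := ler_wpM2l p01 E1; have q2 := ler_wpM2l (ltW p0) E2.
have q1' := ler_wpM2l p01 E2; have q2' := ler_wpM2l (ltW p0) E1.
have lp : 0 <= lam * (1 - 2 * p) by rewrite mulr_ge0//; lra.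
case: ifP => _.
  by have := ler_wpM2l lp gc; lra.
rewrite opprK; have := ler_wpM2l lp cg; lra.
Qed.

(** The complement has mass at most 7/8, by [le_integral_strip] with the bounds 0 and 1. *)
Lemma integral_strip_ge N n : (0 < N)%N ->
  ((8^-1)%:E <= \int[cube_prob n.+1]_x ((strip N (tnth x ord0))%:R : R)%:E)%E.
Proof.
move=> N0; have mS : measurable_fun [set: R] (fun t => (strip N t)%:R : R)
  by exact: measurable_strip_nat.
rewrite (@integral_tuple_prob_tnth _ _ _ unif _ ord0 (fun t => ((strip N t)%:R)%:E)); last 2 first.
- exact/measurable_EFinP.
- by move=> t; rewrite lee_fin.
have mS' : measurable_fun [set: R] (fun t => 1 - (strip N t)%:R : R).
  exact: measurable_funB.
have S1 t : 0 <= 1 - (strip N t)%:R :> R by rewrite subr_ge0; case: (strip N t).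
have H : (\int[unif]_t (1 - (strip N t)%:R)%:E <= (7 / 8 : R)%:E)%E.
  apply: (@le_integral_strip _ N _ (fun=> 0) (fun=> 1)) => //.
  - exact/measurable_EFinP.
  - by move=> t; rewrite lee_fin.
  - by move=> k _; lra.
  - by move=> k t _ _ _; rewrite lee_fin; case: (strip N t); rewrite ?subrr ?subr0.
have := integral_prob_cst (@unif R) 1.
rewrite (_ : (fun _ => _) = (fun t => ((strip N t)%:R)%:E + (1 - (strip N t)%:R)%:E)%E); last first.
  by apply/funext => t; rewrite -EFinD addrC subrK.
have mE1 : measurable_fun [set: R] (fun t => ((strip N t)%:R : R)%:E).
  exact/measurable_EFinP.
have mE2 : measurable_fun [set: R] (fun t => (1 - (strip N t)%:R : R)%:E).
  exact/measurable_EFinP.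
rewrite ge0_integralD//; last by move=> t _; rewrite lee_fin.
set I := (X in (X + _)%E = _ -> _) => HI.
have : ((1 : R)%:E <= I + (7 / 8)%:E)%E by rewrite -HI leeD2l.
rewrite -leeBlDr// -EFinB; apply: le_trans; rewrite lee_fin; lra.
Qed.

End Chernoff.

(** * From tail bounds to a lower bound on the expected error *)

Section Misclassification.
Context {R : realType}.
Variable beta : R.
Hypothesis beta_gt0 : 0 < beta.

(** Average [maxe 0 (1 - t) >= 1 - t] with the weights [w]; when [C] is infinite the right side is
    infinite. It is applied with [C] the near excess and [e] the far product of each noise
    pattern. *)
Lemma average_defect_ge (I : finType) (w e : I -> R) (C : \bar R) :
  (forall s, 0 <= w s) -> \sum_s w s = 1 -> (0 <= C)%E ->
  (1 <= \sum_s (w s)%:E * maxe 0 (1 - (C + (e s)%:E)) +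
        (C + (\sum_s w s * e s)%:E))%E.
Proof.
move=> w0 w1; case: C => [c c0||//]; last first.
  move=> _; rewrite addye// addeC addye ?leey// -ltNye (lt_le_trans (ltNyr 0))//.
  by apply: sume_ge0 => s _; rewrite mule_ge0 ?lee_fin// le_max lexx.
have E s : ((w s)%:E * maxe 0 (1 - (c%:E + (e s)%:E)) =
    (w s * Num.max 0 (1 - (c + e s)))%:E)%E.
  by rewrite EFinM EFin_max EFinB EFinD.
under eq_bigr do rewrite E.
rewrite sumEFin -!EFinD lee_fin.
have H : \sum_s w s * (1 - (c + e s)) <= \sum_s w s * Num.max 0 (1 - (c + e s)).
  by apply: ler_sum => s _; rewrite ler_wpM2l// le_max lexx orbT.
have : \sum_s w s * (1 - (c + e s)) = 1 - c - \sum_s w s * e s.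
  under eq_bigr do rewrite mulrBr mulr1 mulrDr.
  by rewrite sumrB big_split/= -mulr_suml w1 mul1r opprD addrA.
by lra.
Qed.

Definition label_weight m (p : R) (s : {ffun 'I_m -> bool}) : R :=
  \prod_(i < m) (if s i then p else 1 - p).

(** Labels are flipped independently: this is the expansion of the product of two-term sums. *)
Lemma sum_label_weight m (p : R) (F : 'I_m -> bool -> R) :
  \sum_(s : {ffun 'I_m -> bool}) label_weight p s * \prod_(i < m) F i (s i) =
  \prod_(i < m) ((1 - p) * F i false + p * F i true).
Proof.
under eq_bigr do rewrite -big_split/=.
rewrite -(bigA_distr_bigA (fun i b => (if b then p else 1 - p) * F i b)).
apply: eq_bigr => i _ /=.
by rewrite big_bool /= addrC.
Qed.

Lemma label_weight_sum1 m (p : R) :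
  \sum_(s : {ffun 'I_m -> bool}) label_weight p s = 1.
Proof.
have := sum_label_weight p (fun (_ : 'I_m) (_ : bool) => 1).
rewrite [RHS]big1 => [<-|i _]; last by rewrite !mulr1 subrK.
by apply: eq_bigr => s _; rewrite big1// mulr1.
Qed.

Variables (n m K N : nat) (p tau lam : R).
Hypotheses (m_gt0 : (0 < m)%N) (tau_gt0 : 0 < tau) (lam_gt0 : 0 < lam).
Let f := @strip_label R N n.
Let cube := @cube_prob R n.+1.
Let sample := tuple_prob cube m.

(** Normalized by [m * tau], so that its mean will be at most 1/2 and a value below 1 means a near
    contribution below [m * tau]. *)
Definition near_excess (xs : m.-tuple (n.+1.-tuple R)) (x : n.+1.-tuple R) : \bar R :=
  (\sum_(i < m) near_kernel beta K x (tnth xs i) * ((m%:R * tau)^-1)%:E)%E.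

(** [b] tells whether the label of [y] is flipped; averaging over it yields [chernoff_weight]. *)
Definition far_factor (x y : n.+1.-tuple R) (b : bool) : R :=
  expR (lam * ((if b then - f y else f y) * far_kernel beta K x y + tau)).

(* Below 1 only if the total near contribution is less than [m * tau] and the
   total far contribution is less than [- m * tau]. *)
Definition tail_bound (s : {ffun 'I_m -> bool}) (xs : m.-tuple (n.+1.-tuple R))
    (x : n.+1.-tuple R) : \bar R :=
  (near_excess xs x + (\prod_(i < m) far_factor x (tnth xs i) (s i))%:E)%E.

Lemma strip_label_sign y : f y = 1 \/ f y = -1.
Proof. by rewrite /f /strip_label; case: ifP; [left|right]. Qed.

Let mtau_gt0 : 0 < m%:R * tau.
Proof. by rewrite mulr_gt0// ltr0n. Qed.

Lemma near_excess_ge0 xs x : (0 <= near_excess xs x)%E.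
Proof.
apply: sume_ge0 => i _; rewrite mule_ge0 ?near_kernel_ge0//.
by rewrite lee_fin invr_ge0 ltW.
Qed.

Lemma far_factor_ge0 x y b : 0 <= far_factor x y b.
Proof. exact: expR_ge0. Qed.

Lemma tail_bound_ge0 s xs x : (0 <= tail_bound s xs x)%E.
Proof.
apply: adde_ge0; first exact: near_excess_ge0.
by rewrite lee_fin; apply: prodr_ge0 => i _; exact: far_factor_ge0.
Qed.

Lemma measurable_tail_bound d (T : measurableType d) s
    (u : T -> m.-tuple (n.+1.-tuple R)) (v : T -> n.+1.-tuple R) :
  measurable_fun setT u -> measurable_fun setT v ->
  measurable_fun setT (fun z => tail_bound s (u z) (v z)).
Proof.
move=> mu mv.
have mui i : measurable_fun setT (fun z => tnth (u z) i).
  exact: (measurableT_comp (measurable_tnth i) mu).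
apply: emeasurable_funD.
  apply: emeasurable_sum => i; apply: emeasurable_funM => //.
  exact: measurable_near_kernel.
apply/measurable_EFinP; apply: measurable_prod => i _.
apply: measurableT_comp => //; apply: measurable_funM => //.
apply: measurable_funD => //; apply: measurable_funM.
  have mf := measurableT_comp (@measurable_strip_label R N n) (mui i).
  by case: (s i) => //; exact: measurableT_comp.
exact: measurable_far_kernel.
Qed.

(** The vote is at most the capped vote plus the total deviation from the capped kernel. The former
    is below [- m * tau] and the latter below [m * tau], so the vote is negative. *)
Lemma misclassified s xs x : f x = 1 -> (tail_bound s xs x < 1)%E ->
  nw_interp beta xs (noisy_labels f xs s) x = -1.
Proof.
move=> fx tb.
have P0 : 0 <= \prod_(i < m) far_factor x (tnth xs i) (s i).
  by apply: prodr_ge0 => i _; exact: far_factor_ge0.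
have near1 : (near_excess xs x < 1)%E.
  by apply: le_lt_trans tb; rewrite leeDl.
have far1 : \prod_(i < m) far_factor x (tnth xs i) (s i) < 1.
  by rewrite -lte_fin; apply: le_lt_trans tb; rewrite leeDr// near_excess_ge0.
have nearS (i : 'I_m) :
    (near_kernel beta K x (tnth xs i) * ((m%:R * tau)^-1)%:E < 1)%E.
  apply: le_lt_trans near1; rewrite /near_excess (bigD1 i)//= leeDl//.
  by apply: sume_ge0 => j _; rewrite mule_ge0 ?near_kernel_ge0// lee_fin invr_ge0 ltW.
(* If [x] were a sample point, the near excess would be infinite; [M], an integer above [m * tau],
   gives the contradiction. *)
rewrite /nw_interp; case: pickP => [i /eqP xi|_].
  have := nearS i; rewrite xi.
  pose M := (Num.trunc (m%:R * tau)).+1.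
  have : (M%:R%:E * ((m%:R * tau)^-1)%:E <=
      near_kernel beta K x x * ((m%:R * tau)^-1)%:E)%E.
    by rewrite lee_wpmul2r ?near_kernel_diag// lee_fin invr_ge0 ltW.
  move=> /le_lt_trans /[apply]; rewrite -EFinM lte_fin ltr_pdivrMr// mul1r.
  by move=> /(lt_trans (truncnS_gt _)); rewrite ltxx.
rewrite /sgn1 ifN// -ltNge.
set y := fun i => if s i then - f (tnth xs i) else f (tnth xs i).
have y1 i : `|y i| = 1.
  rewrite /y; have [->|->] := strip_label_sign (tnth xs i); case: (s i);
    by rewrite ?opprK ?normrN normr1.
set w := fun i => edist x (tnth xs i) `^ (- beta).
set g := fun i => far_kernel beta K x (tnth xs i).
rewrite (eq_bigr (fun i => y i * w i)) => [|i _]; last by rewrite tnth_mktuple.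
(* Take the logarithm of the far product; the shift [tau] occurs once per sample point. *)
have sumfar : \sum_(i < m) (y i * g i) < - (m%:R * tau).
  move: far1; rewrite -expR_sum expR_lt1 -mulr_sumr pmulr_rlt0//.
  by rewrite big_split/= sumr_const card_ord -[tau *+ m]mulr_natl -ltrBrDr sub0r; apply.
have sumnear : \sum_(i < m) `|w i - g i| < m%:R * tau.
  move: near1; rewrite /near_excess => near1.
  rewrite -[ltRHS]mul1r -ltr_pdivrMr//.
  rewrite -lte_fin; apply: le_lt_trans near1; rewrite mulr_suml -sumEFin.
  apply: lee_sum => i _; rewrite EFinM; apply: lee_wpmul2r.
    by rewrite lee_fin invr_ge0 ltW.
  exact: kernel_split.
have : \sum_(i < m) y i * w i <= \sum_(i < m) y i * g i + \sum_(i < m) `|w i - g i|.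
  rewrite -big_split/=; apply: ler_sum => i _.
  rewrite -lerBlDl -mulrBr (le_trans (ler_norm _))// normrM y1 mul1r//.
by lra.
Qed.

(** A measurable minorant of the misclassification indicator, supported on the strips. *)
Definition error_bound (s : {ffun 'I_m -> bool}) (xs : m.-tuple (n.+1.-tuple R))
    (x : n.+1.-tuple R) : \bar R :=
  ((strip N (tnth x ord0))%:R%:E * maxe 0 (1 - tail_bound s xs x))%E.

Lemma error_bound_ge0 s xs x : (0 <= error_bound s xs x)%E.
Proof. by rewrite mule_ge0 ?lee_fin// le_max lexx. Qed.

Lemma measurable_error_bound d (T : measurableType d) s
    (u : T -> m.-tuple (n.+1.-tuple R)) (v : T -> n.+1.-tuple R) :
  measurable_fun setT u -> measurable_fun setT v ->
  measurable_fun setT (fun z => error_bound s (u z) (v z)).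
Proof.
move=> mu mv; apply: emeasurable_funM.
  apply/measurable_EFinP; apply: (measurableT_comp (measurable_strip_nat N)).
  exact: (measurableT_comp (measurable_tnth ord0) mv).
apply: measurable_maxe => //; apply: emeasurable_funB => //.
exact: measurable_tail_bound.
Qed.

Lemma error_bound_le s xs x :
  (error_bound s xs x <=
   ((nw_interp beta xs (noisy_labels f xs s) x != f x)%:R)%:E)%E.
Proof.
rewrite /error_bound; case: (boolP (strip N (tnth x ord0))) => xS; last first.
  by rewrite mul0e lee_fin.
have fx : f x = 1 by rewrite /f /strip_label xS.
rewrite mul1e; have [tb|tb] := ltP (tail_bound s xs x) 1%E.
  rewrite misclassified// fx (_ : -1 != 1 :> R); last by apply/eqP; lra.
  rewrite ge_max; apply/andP; split; first by rewrite lee_fin.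
  move: tb (tail_bound_ge0 s xs x); case: (tail_bound s xs x) => [r||]// _.
  by rewrite -EFinB !lee_fin => r0; rewrite lerBlDr lerDl.
rewrite max_l ?lee_fin//.
move: tb; case: (tail_bound s xs x) => [r||]//= tb; rewrite ?leNye//.
by rewrite -EFinB lee_fin subr_le0 -lee_fin.
Qed.

Hypotheses (p_gt0 : 0 < p) (p_lt1 : p < 1).

Let w := @label_weight m p.

Lemma label_weight_ge0 s : 0 <= w s.
Proof. by apply: prodr_ge0 => i _; case: (s i); rewrite ?subr_ge0 ltW. Qed.

Let avg_bound xs x : \bar R := (\sum_s (w s)%:E * error_bound s xs x)%E.

Let avg_bound_ge0 xs x : (0 <= avg_bound xs x)%E.
Proof.
by apply: sume_ge0 => s _; rewrite mule_ge0 ?error_bound_ge0// lee_fin label_weight_ge0.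
Qed.

Let measurable_avg_bound d (T : measurableType d)
    (u : T -> m.-tuple (n.+1.-tuple R)) (v : T -> n.+1.-tuple R) :
  measurable_fun setT u -> measurable_fun setT v ->
  measurable_fun setT (fun z => avg_bound (u z) (v z)).
Proof.
move=> mu mv; apply: emeasurable_sum => s; apply: emeasurable_funM => //.
exact: measurable_error_bound.
Qed.

(** The indicator is replaced by its measurable minorant inside the iterated integrals, which then
    become integrals against product probabilities, where Tonelli applies. *)
Lemma expected_error_ge_avg :
  (\int[cube]_x \int[sample]_xs avg_bound xs x <=
   expected_error beta (@cube_density R n.+1) f p m)%E.
Proof.
have meb s xs : measurable_fun [set: n.+1.-tuple R] (error_bound s xs).
  exact: (@measurable_error_bound _ _ s (fun=> xs) id).
(* The test point is put outermost, so that the sample can be analysed at a fixed [x]. *)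
have swap : (\int[cube]_x \int[sample]_xs avg_bound xs x =
    \int[sample]_xs \int[cube]_x avg_bound xs x)%E.
  apply: (@fubini_tonelli _ _ _ _ _ cube sample (fun z => avg_bound z.2 z.1)) => //.
  exact: measurable_avg_bound.
have mG : measurable_fun [set: m.-tuple (n.+1.-tuple R)]
    (fun xs => \int[cube]_x avg_bound xs x)%E.
  apply: (@measurable_fun_fubini_tonelli_F _ _ _ _ _ cube
    (fun z => avg_bound z.1 z.2)) => //.
  exact: measurable_avg_bound.
have G0 xs : (0 <= \int[cube]_x avg_bound xs x)%E by exact: integral_ge0.
pose c (x : n.+1.-tuple R) := [forall i, in01 (tnth x i)].
rewrite swap -(@iter_int_tuple_prob _ _ _ cube
  (fun F => intRd (fun x => (c x)%:R%:E * F x)%E))//; last first.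
  move=> F mF F0; rewrite -intRd_cube_density//; congr intRd; apply/funext => x.
  by rewrite cube_densityE.
rewrite -iter_int_weight; last exact: intRd0.
apply: le_iter_int => [F F0|F G F0 FG|xs|xs]; [exact: intRd_ge0|exact: le_intRd| |].
  by rewrite mule_ge0// lee_fin prodr_ge0.
under [in leRHS]eq_bigr do rewrite cube_densityE.
apply: lee_wpmul2l; first by rewrite lee_fin prodr_ge0.
rewrite ge0_integral_sum//; last 2 first.
- by move=> s; apply: emeasurable_funM.
- by move=> s x _; rewrite mule_ge0 ?error_bound_ge0// lee_fin label_weight_ge0.
apply: lee_sum => s _.
rewrite ge0_integralZl_EFin//; last 2 first.
- by move=> x _; exact: error_bound_ge0.
- exact: label_weight_ge0.
apply: lee_wpmul2l; first by rewrite lee_fin label_weight_ge0.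
rewrite -intRd_cube_density//; last by move=> x; exact: error_bound_ge0.
apply: le_intRd => x.
  by rewrite mule_ge0 ?error_bound_ge0// lee_fin cube_density_ge0.
rewrite EFinM lee_wpmul2l ?error_bound_le//.
by rewrite lee_fin cube_density_ge0.
Qed.

Variable q : R.
Hypothesis q_ge0 : 0 <= q.
Hypothesis near_int : forall x : n.+1.-tuple R,
  (\int[cube]_y near_kernel beta K x y <= (tau / 2)%:E)%E.
Hypothesis far_int : forall x : n.+1.-tuple R, (forall i, in01 (tnth x i)) ->
  (\int[cube]_y (chernoff_weight beta f p lam tau K x y)%:E <= q%:E)%E.

(** Averaged over noise and sample, 1 is at most the error bound plus the near excess, of mean at
    most 1/2, plus a product of independent Chernoff weights, of mean at most [q ^+ m]. *)
Lemma integral_avg_bound_ge (x : n.+1.-tuple R) :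
  (forall i, in01 (tnth x i)) -> strip N (tnth x ord0) ->
  ((2^-1 - q ^+ m)%:E <= \int[sample]_xs avg_bound xs x)%E.
Proof.
move=> x01 xS.
have psi0 y : 0 <= chernoff_weight beta f p lam tau K x y.
  by rewrite addr_ge0// mulr_ge0 ?expR_ge0// ?subr_ge0 ltW.
have mpsi : measurable_fun [set: n.+1.-tuple R] (chernoff_weight beta f p lam tau K x).
  apply: (@measurable_chernoff_weight _ _ _ _ _ f p lam tau K (fun=> x) id) => //.
  exact: measurable_strip_label.
pose E (xs : m.-tuple (n.+1.-tuple R)) : R :=
  \prod_(i < m) chernoff_weight beta f p lam tau K x (tnth xs i).
have pointwise xs : (1 <= avg_bound xs x + (near_excess xs x + (E xs)%:E))%E.
  have := @average_defect_ge _ (@label_weight m p)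
    (fun s => \prod_(i < m) far_factor x (tnth xs i) (s i))
    _ label_weight_ge0 (label_weight_sum1 m p) (near_excess_ge0 xs x).
  rewrite (sum_label_weight p (fun i => far_factor x (tnth xs i))) /avg_bound.
  by under [in X in _ -> X]eq_bigr do rewrite /error_bound xS mul1e.
have mE : measurable_fun [set: m.-tuple (n.+1.-tuple R)] (fun xs => (E xs)%:E).
  apply/measurable_EFinP; apply: measurable_prod => i _.
  exact: (measurableT_comp mpsi (measurable_tnth i)).
have E0 xs : 0 <= E xs by exact: prodr_ge0.
have mnk : measurable_fun [set: n.+1.-tuple R] (near_kernel beta K x).
  exact: (@measurable_near_kernel _ beta _ _ K _ (fun=> x) id).
have mnx : measurable_fun [set: m.-tuple (n.+1.-tuple R)] (near_excess ^~ x).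
  apply: emeasurable_sum => i; apply: emeasurable_funM => //.
  exact: (measurableT_comp mnk (measurable_tnth i)).
have mav : measurable_fun [set: m.-tuple (n.+1.-tuple R)] (avg_bound ^~ x).
  exact: (@measurable_avg_bound _ _ id (fun=> x)).
have mc0 : 0 <= (m%:R * tau)^-1 by rewrite invr_ge0 ltW.
have In : (\int[sample]_xs near_excess xs x <= (2^-1)%:E)%E.
  rewrite ge0_integral_sum//; last 2 first.
  - move=> i; apply: emeasurable_funM => //.
    exact: (measurableT_comp mnk (measurable_tnth i)).
  - by move=> i xs _; rewrite mule_ge0 ?near_kernel_ge0// lee_fin.
  apply: (@le_trans _ _ (\sum_(i < m) (tau / 2 * (m%:R * tau)^-1)%:E)%E).
    apply: lee_sum => i _.
    rewrite ge0_integralZr//; last 2 first.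
    - exact: (measurableT_comp mnk (measurable_tnth i)).
    - by move=> xs _; exact: near_kernel_ge0.
    rewrite EFinM lee_wpmul2r ?lee_fin//.
    rewrite (@integral_tuple_prob_tnth _ _ _ cube m i (near_kernel beta K x))//.
    by move=> y; exact: near_kernel_ge0.
  rewrite sumEFin lee_fin sumr_const card_ord -[leLHS]mulr_natl.
  have c0 : m%:R != 0 :> R by rewrite pnatr_eq0 -lt0n.
  have t0 : tau != 0 by rewrite gt_eqF.
  rewrite [leLHS](_ : _ = 2^-1)//.
  by move: (m%:R : R) c0 => c c0; field; rewrite c0 t0.
have If : (\int[sample]_xs (E xs)%:E <= (q ^+ m)%:E)%E.
  apply: (@integral_tuple_prob_prod _ _ _ cube m
    (fun=> chernoff_weight beta f p lam tau K x)) => // i.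
  exact: far_int.
have : (1 <= \int[sample]_xs avg_bound xs x + (2^-1 + q ^+ m)%:E)%E.
  rewrite -(integral_prob_cst sample 1).
  apply: (@le_trans _ _ (\int[sample]_xs (avg_bound xs x + (near_excess xs x + (E xs)%:E)))%E).
    apply: le_integral_ge0 => xs; first by rewrite lee_fin.
    exact: pointwise.
  have EE0 xs : (0 <= (E xs)%:E)%E by rewrite lee_fin.
  have nE0 xs : (0 <= near_excess xs x + (E xs)%:E)%E.
    by rewrite adde_ge0// near_excess_ge0.
  rewrite ge0_integralD//; last exact: emeasurable_funD.
  rewrite leeD2l// ge0_integralD//; last by move=> xs _; exact: near_excess_ge0.
  by rewrite EFinD leeD.
rewrite -leeBlDr// -EFinB; apply: le_trans; rewrite lee_fin; lra.
Qed.

(** Integrate the bound for a fixed test point over the strips, whose mass is at least 1/8. *)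
Lemma expected_error_ge : (0 < N)%N -> q ^+ m <= 2^-1 ->
  (((2^-1 - q ^+ m) / 8)%:E <= expected_error beta (@cube_density R n.+1) f p m)%E.
Proof.
move=> N0 qm; apply: le_trans expected_error_ge_avg.
have k0 : 0 <= 2^-1 - q ^+ m by rewrite subr_ge0.
have mS : measurable_fun [set: n.+1.-tuple R] (fun x => ((strip N (tnth x ord0))%:R : R)%:E).
  apply/measurable_EFinP.
  exact: (measurableT_comp (measurable_strip_nat N) (measurable_tnth ord0)).
apply: (@le_trans _ _ (\int[cube]_x ((2^-1 - q ^+ m)%:E * ((strip N (tnth x ord0))%:R : R)%:E))%E).
  rewrite ge0_integralZl_EFin// EFinM; apply: lee_wpmul2l; first by rewrite lee_fin.
  exact: integral_strip_ge.
apply: (@le_integral_tuple_prob _ _ _ (@unif R) n.+1 `[0, 1]%classic) => //.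
- exact: unif_setC01.
- exact: emeasurable_funM.
- by move=> x; rewrite mule_ge0// lee_fin.
- apply: (@measurable_fun_fubini_tonelli_F _ _ _ _ _ sample
    (fun z => avg_bound z.2 z.1)) => //.
  exact: measurable_avg_bound.
- by move=> x; exact: integral_ge0.
move=> x x01; case: (boolP (strip N (tnth x ord0))) => xS; last first.
  by rewrite mule0; exact: integral_ge0.
by rewrite mule1; apply: integral_avg_bound_ge.
Qed.

End Misclassification.

(** * Passage to the limit and choice of the parameters *)

Lemma expr_lt_eventually (R : realType) (r e : R) : 0 <= r -> r < 1 -> 0 < e ->
  exists M, forall m, (M <= m)%N -> r ^+ m < e.
Proof.
move=> r0 r1 e0; have r1' : `|r| < 1 by rewrite ger0_norm.
have /cvgrPdist_lt/(_ e e0)[M _ HM] := cvg_expr r1'.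
by exists M => m /HM /=; rewrite sub0r normrN ger0_norm// exprn_ge0.
Qed.

Lemma limn_einf_ge (R : realType) (u : (\bar R)^nat) (c : \bar R) M :
  (forall m, (M <= m)%N -> (c <= u m)%E) -> (c <= limn_einf u)%E.
Proof.
move=> cu; rewrite limn_einf_lim; apply: lime_ge; first exact: is_cvg_einfs.
exists M => // k /= Mk; apply: le_ereal_inf_tmp => _ [m /= km <-].
by apply: cu; exact: leq_trans km.
Qed.

Theorem theorem4 (R : realType) :
  exists C1 C2 : R, (0 < C1 < 1) /\ (0 < C2 < 1) /\
  forall (d : nat) (beta : R), 0 < beta -> beta < d%:R ->
  exists (mu f : d.-tuple R -> R),
    is_density mu /\ measurable_fun setT f /\
    (forall x, f x = 1 \/ f x = -1) /\ regular mu f /\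
    forall p : R, 0 < p -> p < 49 / 100 ->
      ((C2 * (C1 `^ beta * (1 - beta / d%:R)))%:E
         <= limn_einf (expected_error beta mu f p))%E.
Proof.
(* Both factors of [C1 ^ beta * (1 - beta / d)] are at most 1, so it is enough to reach 1/32. *)
exists 2^-1, 32^-1; split; first lra; split; first lra.
case=> [|n] beta b0 bd; first by move: (lt_trans b0 bd); rewrite ltxx.
have one_powR x : 1 `^ x = 1 :> R by rewrite powR1.
set b : R := 2 `^ beta; have bpos : 0 < b by exact: powR_gt0.
pose r := b / 2 ^+ n.+1.
have r0 : 0 < r by rewrite divr_gt0// exprn_gt0.
have r1 : r < 1.
  rewrite ltr_pdivrMr ?exprn_gt0// mul1r -powR_mulrn//.
  by rewrite /b /powR !gt_eqF// ltr_expR ltr_pM2r// ln_gt0// ltr1n.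
(* [tau], [K] and [N] are fixed before [p], since the target may not depend on [p]. [K] makes the
   near mean at most [tau / 2], and [N] makes the capped kernel vary by at most a factor 2 within a
   period. *)
pose tau : R := Num.sqrt n.+1%:R `^ (- beta) / 25 / 40.
have tau0 : 0 < tau by rewrite !divr_gt0// powR_gt0// sqrtr_gt0 ltr0n.
have A0 : 0 < b * 2 ^+ n.+1 by rewrite mulr_gt0// exprn_gt0.
have [K HK] : exists K, b * 2 ^+ n.+1 * r ^+ K / (1 - r) <= tau / 2.
  have e0 : 0 < tau / 2 * (1 - r) / (b * 2 ^+ n.+1).
    by rewrite divr_gt0// mulr_gt0 ?divr_gt0// subr_gt0.
  have [K /(_ K (leqnn K)) HK] := expr_lt_eventually (ltW r0) r1 e0.
  exists K; rewrite ler_pdivrMr ?subr_gt0// mulrC -ler_pdivlMr//; exact: ltW.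
have [N N0 HN] : exists2 N, (0 < N)%N & (1 + 2 ^+ K / N%:R) `^ beta <= 2.
  have c0 : 0 < 2 `^ beta^-1 - 1 :> R.
    rewrite subr_gt0 -[ltLHS](one_powR beta^-1).
    by apply: gt0_ltr_powR; rewrite ?invr_gt0 ?nnegrE ?ler01 ?ltr1n.
  pose N := (Num.trunc (2 ^+ K / (2 `^ beta^-1 - 1) : R)).+1.
  exists N => //; have N0 : 0 < N%:R :> R by rewrite ltr0n.
  have H : 1 + 2 ^+ K / N%:R <= 2 `^ beta^-1 :> R.
    rewrite -lerBrDl ler_pdivrMr// mulrC -ler_pdivrMr//.
    by rewrite /N ltW// truncnS_gt.
  apply: (@le_trans _ _ ((2 `^ beta^-1) `^ beta)).
    apply: ge0_ler_powR => //; rewrite ?nnegrE ?powR_ge0 ?(ltW b0)//.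
  by rewrite -powRrM mulVf ?gt_eqF// powRr1.
exists (@cube_density R n.+1), (@strip_label R N n).
split; first exact: is_density_cube.
split; first exact: measurable_strip_label.
split; first exact: strip_label_sign.
split; first exact: regular_strip_label.
move=> p p0 p1.
pose B := b ^+ K + tau.
have tauB : tau <= B by rewrite lerDr exprn_ge0// ltW.
have B0 : 0 < B by exact: lt_le_trans tauB.
(* This value turns the condition [2 * (lam * B) ^+ 2 <= lam * tau] into an equality. *)
pose lam := tau / (2 * B ^+ 2).
have lam0 : 0 < lam by rewrite divr_gt0// mulr_gt0// exprn_gt0.
have lamBE : lam * B = tau / B / 2.
  by rewrite /lam; field; rewrite gt_eqF.
have tB : tau / B <= 1 by rewrite ler_pdivrMr// mul1r.
have tB0 : 0 < tau / B by rewrite divr_gt0.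
have lamB : lam * B <= 2^-1 by rewrite lamBE; lra.
have lamtau : lam * tau = 2 * (lam * B) ^+ 2.
  by rewrite /lam; field; rewrite gt_eqF.
have lamtau2 : lam * tau <= 2^-1 by rewrite lamtau lamBE; nra.
have lamtau0 : 0 < lam * tau by rewrite mulr_gt0.
pose q := 1 - lam * tau.
have q0 : 0 <= q by rewrite /q; lra.
have q1 : q < 1 by rewrite /q; lra.
(* Once [q ^+ m < 1/4], the error is at least (1/2 - 1/4) / 8 = 1/32. *)
have [M HM] := expr_lt_eventually q0 q1 (ltac:(by rewrite invr_gt0) : 0 < 4^-1 :> R).
apply: (@limn_einf_ge _ _ _ M.+1) => m Mm.
have m0 : (0 < m)%N by exact: leq_trans Mm.
have qm := HM m (ltnW Mm).
apply: (@le_trans _ _ ((2^-1 - q ^+ m) / 8)%:E).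
  rewrite lee_fin; apply: (@le_trans _ _ 32^-1); last by lra.
  rewrite ler_piMr//; apply: mulr_ile1.
  - exact: powR_ge0.
  - by rewrite subr_ge0 ler_pdivrMr ?ltr0n// mul1r ltW.
  - rewrite -[leRHS](one_powR beta); apply: ge0_ler_powR; rewrite ?nnegrE ?(ltW b0)//; lra.
  - by rewrite gerBl divr_ge0// ltW.
have p1' : p < 1 by lra.
apply: (@expected_error_ge _ beta b0 n m K N p tau lam) => //.
- move=> x; apply: le_trans (integral_near_kernel K x bd) _.
  by rewrite lee_fin.
- move=> x x01; apply: integral_chernoff_weight => //; first exact: ltW.
  by rewrite lamtau.
- by lra.
Qed.
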